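(* Let $\mathcal{G}$ and $\mathcal{K}$ be groupoids such that the sets of objects $\mathcal{G}_0$ and $\mathcal{K}_0$ are finite, let $A$ be a $\mathcal{G}$-graded algebra and let $X$ be a finite split $(\mathcal{G}_{\alpha},\mathcal{K}_{\beta})$-set. If the action $\beta$ of $\mathcal{K}$ on $X$ is fully faithful, then there is an isomorphism of algebras $$(A \#_{\alpha}^{\mathcal{G}} X) *_{\gamma} \mathcal{K} \simeq \mathrm{End}\big((A \#_{\alpha}^{\mathcal{G}} X)_{A \#_{\lambda}^{\mathcal{G}} O^{\mathcal{K}}}\big),$$ where $O^{\mathcal{K}}$ is the set of $\mathcal{K}$-orbits of $X$ and the right-hand side is the algebra of endomorphisms of $A \#_{\alpha}^{\mathcal{G}} X$ as a right $A \#_{\lambda}^{\mathcal{G}} O^{\mathcal{K}}$-module.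
   Context: All algebras are associative and unital over a fixed field $\Bbbk$. Groupoids. A groupoid $\mathcal{G}$ is a small category in which every morphism is invertible; it is identified with its set of morphisms. $d(g), r(g)$ are the domain and range of $g$, $\mathcal{G}_0$ is the set of objects, identified with the identity morphisms, so $\mathcal{G}_0\subseteq \mathcal{G}$. The product $gh$ is defined iff $d(g)=r(h)$. $D_e=\{g: d(g)=e\}$, for $e \in \mathcal{G}_0$. $\mathcal{G}$-sets. An action of $\mathcal{G}$ on a set $X$ is $\alpha=(X_g,\alpha_g)_{g\in\mathcal{G}}$ with $X_g=X_{r(g)}\subseteq X$ and $\alpha_g:X_{g^{-1}}\to X_g$ bijections such that $\alpha_e=\mathrm{id}_{X_e}$ for $e\in\mathcal{G}_0$, and $\alpha_g(\alpha_h(x))=\alpha_{gh}(x)$ whenever $d(g)=r(h)$ and $x\in X_{h^{-1}}$. Then $X$ is a $\mathcal{G}$-set; it is split if $X=\coprod_{e\in\mathcal{G}_0}X_e$ (disjoint union). The action is fully faithful if $\alpha_g(x)=x$ for some $x\in X_g\cap X_{g^{-1}}$ implies $g\in\mathcal{G}_0$. $(\mathcal{G}_\alpha,\mathcal{K}_\beta)$-sets. $X$ is a $(\mathcal{G}_\alpha,\mathcal{K}_\beta)$-set if it is a $\mathcal{G}$-set via $\alpha=(X_g,\alpha_g)_{g\in\mathcal{G}}$, a $\mathcal{K}$-set via $\beta=(Y_k,\beta_k)_{k\in\mathcal{K}}$, and for all $g\in\mathcal{G},k\in\mathcal{K}$: (i) $\alpha_g(X_{g^{-1}}\cap Y_k)\subseteq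 X_g\cap Y_k$ and $\beta_k(X_g\cap Y_{k^{-1}})\subseteq X_g\cap Y_k$; (ii) $\alpha_g(\beta_k(x))=\beta_k(\alpha_g(x))$ for all $x\in X_{g^{-1}}\cap Y_{k^{-1}}$. It is split if it is split both as a $\mathcal{G}$-set and as a $\mathcal{K}$-set. Graded algebras and smash product. An algebra $A$ is $\mathcal{G}$-graded if $A=\oplus_{g\in\mathcal{G}}A_g$ for subspaces $A_g$ with $A_gA_h\subseteq A_{gh}$ if $d(g)=r(h)$ and $A_gA_h=0$ otherwise. When $\mathcal{G}_0$ is finite, each $A_e$ ($e\in\mathcal{G}_0$) is unital with identity $1_e$ and $1_A=\sum_{e}1_e$. For a split $\mathcal{G}$-set $X$ via $\alpha$, $A\#_\alpha^{\mathcal{G}}X=\oplus_{g\in\mathcal{G}}\oplus_{x\in X_{d(g)}}A_g\delta_x$ ($\delta_x$ symbols) with $(a_g\delta_x)(b_h\delta_y)=a_gb_h\delta_y$ if $d(g)=r(h)$ and $\alpha_h(y)=x$, and $0$ otherwise. For $X$ finite it is unital with identity $\sum_{e\in\mathcal{G}_0}\sum_{x\in X_e}1_e\delta_x$. Skew groupoid ring. An action of $\mathcal{K}$ on an algebra $B$ is $\gamma=(E_k,\gamma_k)_{k\in\mathcal{K}}$ with $E_k=E_{r(k)}$ an ideal of $B$ and $\gamma_k:E_{k^{-1}}\to E_k$ algebra isomorphisms with $\gamma_p=\mathrm{id}_{E_p}$ for $p\in\mathcal{K}_0$ and $\gamma_{kl}(x)=\gamma_k(\gamma_l(x))$ for $d(k)=r(l)$,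 $x\in E_{l^{-1}}$. Then $B*_\gamma\mathcal{K}=\oplus_{k\in\mathcal{K}}E_k\delta_k$ with $(x\delta_k)(y\delta_l)=x\gamma_k(y)\delta_{kl}$ if $d(k)=r(l)$ and $0$ otherwise. The action $\gamma$ of $\mathcal{K}$ on $A\#_\alpha^{\mathcal{G}}X$ is: $E_k=\oplus_{g\in\mathcal{G}}\oplus_{x\in Y_k\cap X_{d(g)}}A_g\delta_x$ and $\gamma_k(a_g\delta_x)=a_g\delta_{\beta_k(x)}$ for $x\in Y_{k^{-1}}\cap X_{d(g)}$. Orbits. For $x\in Y_p$, $p\in\mathcal{K}_0$, $o(x)=\{\beta_k(x):k\in D_p\}$ and $O^{\mathcal{K}}=\{o(x):x\in X\}$. $O^{\mathcal{K}}$ is a (split) $\mathcal{G}$-set via $\lambda=(O^{\mathcal{K}}_g,\lambda_g)_{g\in\mathcal{G}}$, $O^{\mathcal{K}}_g=\{o(x):x\in X_g\}$, $\lambda_g(o(x))=o(\alpha_g(x))$ for $x\in X_{g^{-1}}$. $A\#_\alpha^{\mathcal{G}}X$ is a right $A\#_\lambda^{\mathcal{G}}O^{\mathcal{K}}$-module by right multiplication via the injective algebra map $\varphi^*:A\#_\lambda^{\mathcal{G}}O^{\mathcal{K}}\to A\#_\alpha^{\mathcal{G}}X$, $\varphi^*(a_g\delta_{o(x)})=\sum_{y\in X_{d(g)},\,o(y)=o(x)}a_g\delta_y$. *)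

(* Defs.v *)
From HB Require Import structures.
From mathcomp Require Import all_boot all_algebra finmap.
From mathcomp Require Import boolp classical_sets functions cardinality fsbigop.

Set Implicit Arguments.
Unset Strict Implicit.
Unset Printing Implicit Defensive.

Import GRing.Theory.
Local Open Scope ring_scope.

(* Associative unital algebras over a field.  The library's [algType F] is
   nontrivial by construction, whereas the algebras below may be zero (e.g. a
   smash product with the empty set), so this is [algType] without 1 != 0. *)
Record algebra (F : fieldType) := Algebra {
  alg_lmod : lmodType F;
  alg_one : alg_lmod;
  alg_mul : alg_lmod -> alg_lmod -> alg_lmod;
  alg_mulA : associative alg_mul;
  alg_mul1r : left_id alg_one alg_mul;
  alg_mulr1 : right_id alg_one alg_mul;
  alg_mulDl : left_distributive alg_mul +%R;
  alg_mulDr : right_distributive alg_mul +%R;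
  alg_scaleAl : forall (k : F) u v, k *: alg_mul u v = alg_mul (k *: u) v;
  alg_scaleAr : forall (k : F) u v, k *: alg_mul u v = alg_mul u (k *: v)
}.

Definition alg_sort (F : fieldType) (A : algebra F) : Type := alg_lmod A.
Coercion alg_sort : algebra >-> Sortclass.

HB.instance Definition _ (F : fieldType) (A : algebra F) :=
  GRing.Lmodule.copy (alg_sort A) (alg_lmod A).
HB.instance Definition _ (F : fieldType) (A : algebra F) :=
  GRing.Zmodule_isPzRing.Build (alg_sort A) (@alg_mulA F A) (@alg_mul1r F A)
    (@alg_mulr1 F A) (@alg_mulDl F A) (@alg_mulDr F A).

Section AlgebraTheory.
Variables (F : fieldType) (A : algebra F).
Lemma algAl (k : F) (u v : A) : k *: (u * v) = (k *: u) * v.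
Proof. exact: alg_scaleAl. Qed.
Lemma algAr (k : F) (u v : A) : k *: (u * v) = u * (k *: v).
Proof. exact: alg_scaleAr. Qed.
End AlgebraTheory.

Definition alg_isom (F : fieldType) (A B : algebra F) : Prop :=
  exists f : A -> B, [/\ linear f, monoid_morphism f & bijective f].

Section DirectSum.
Variables (F : fieldType) (V : lmodType F) (I : choiceType).
Variable S : I -> submodClosed V.

Definition dsum_pred : {pred I -> V} := fun c =>
  `[< (forall i, c i \in S i) /\ finite_set [set i | c i != 0]%classic >].

(* The external direct sum of the S i: finitely supported families. *)
Record dsum := DSum { dval :> I -> V; dval_subproof : dval \in dsum_pred }.

HB.instance Definition _ := [isSub for dval].
HB.instance Definition _ := [Choice of dsum by <:].

Fact dsum_submod : submod_closed dsum_pred.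
Proof.
split.
  apply/asboolP; split=> [i|]; first exact: rpred0.
  by rewrite (_ : [set i | _]%classic = set0) //; apply/seteqP; split=> i //=; rewrite eqxx.
move=> k u v /asboolP[uS uf] /asboolP[vS vf]; apply/asboolP; split=> [i|].
  by rewrite /= rpredD ?rpredZ.
apply: (@sub_finite_set _ _ ([set i | u i != 0] `|` [set i | v i != 0])%classic).
  move=> i /= h; have [ui|] := eqVneq (u i) 0; last by left.
  right; apply: contraNneq h => vi; apply/eqP.
  by rewrite -[LHS]/(k *: u i + v i) ui vi scaler0 addr0.
by rewrite finite_setU.
Qed.

HB.instance Definition _ := GRing.SubChoice_isSubLmodule.Build _ _ _ dsum
  (GRing.submod_closed_semi dsum_submod).

Lemma dsumP (c d : dsum) : (forall i, c i = d i) <-> c = d.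
Proof. by split=> [cd|-> //]; apply/val_inj/funext. Qed.

Lemma dval_in (c : dsum) i : c i \in S i.
Proof. by have /asboolP[] := dval_subproof c. Qed.

Lemma dsum_fin (c : dsum) : exists D : {fset I}, forall i, i \notin D -> c i = 0.
Proof.
have /asboolP[_ cf] := dval_subproof c.
exists (fset_set [set i | c i != 0]%classic) => i.
by rewrite in_fset_set // notin_setE /= => /negP/negPn/eqP.
Qed.

Lemma dval0 i : (0 : dsum) i = 0. Proof. by []. Qed.
Lemma dvalD (c d : dsum) i : (c + d) i = c i + d i. Proof. by []. Qed.
Lemma dvalZ k (c : dsum) i : (k *: c) i = k *: c i. Proof. by []. Qed.
Lemma dval_sum (J : Type) (s : seq J) (P : pred J) (f : J -> dsum) i :
  (\sum_(j <- s | P j) f j) i = \sum_(j <- s | P j) f j i.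
Proof. by elim/big_rec2: _ => //= j _ c _ <-. Qed.

Definition dsingle_fun i v : I -> V :=
  fun j => if (j == i) && (v \in S i) then v else 0.

Fact dsingle_subproof i v : dsingle_fun i v \in dsum_pred.
Proof.
apply/asboolP; rewrite /dsingle_fun; split=> [j|].
  by case: ifP => [/andP[/eqP-> //]|_]; rewrite rpred0.
apply: (@sub_finite_set _ _ [set i]%classic) => // j /=.
by case: ifP => [/andP[/eqP->]|]; rewrite ?eqxx.
Qed.

(* The element v delta_i, for v in S i (and 0 otherwise). *)
Definition dsingle i v : dsum := DSum (dsingle_subproof i v).

Lemma dsingleE i v j : v \in S i -> dsingle i v j = if j == i then v else 0.
Proof. by rewrite /= /dsingle_fun => ->; rewrite andbT. Qed.

Lemma dsingle_linear i k u v : u \in S i -> v \in S i ->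
  dsingle i (k *: u + v) = k *: dsingle i u + dsingle i v.
Proof.
move=> uS vS; apply/dsumP => j; rewrite dvalD dvalZ !dsingleE ?rpredD ?rpredZ //.
by case: ifP => // _; rewrite scaler0 addr0.
Qed.

Lemma dsingle0 i : dsingle i 0 = 0.
Proof. by apply/dsumP => j /=; rewrite /dsingle_fun if_same. Qed.

Lemma dsum_expand (c : dsum) (D : {fset I}) : (forall i, i \notin D -> c i = 0) ->
  c = \sum_(i <- D) dsingle i (c i).
Proof.
move=> cD; apply/dsumP => j; rewrite dval_sum.
under eq_bigr do rewrite dsingleE ?dval_in //.
have [jD|/[dup] jD /cD->] := boolP (j \in D).
  rewrite (big_fsetD1 j) //= eqxx big1_seq ?addr0 // => i /andP[_].
  by rewrite !inE eq_sym => /andP[/negPf-> _].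
rewrite big1_seq // => i /andP[_ iD]; case: eqP => // ji.
by rewrite ji iD in jD.
Qed.

Lemma dsum_ind (P : dsum -> Prop) : P 0 ->
  (forall i v c, v \in S i -> P c -> P (dsingle i v + c)) -> forall c, P c.
Proof.
move=> P0 PD c; have [D /dsum_expand->] := dsum_fin c.
by elim/big_rec: _ => // i d _; apply: PD; exact: dval_in.
Qed.

Section Lift.
Variable W : lmodType F.
Implicit Types c d : dsum.

Definition linear_on (phi : I -> V -> W) := forall i k u v,
  u \in S i -> v \in S i -> phi i (k *: u + v) = k *: phi i u + phi i v.

(* The map \sum_i v_i delta_i |-> \sum_i phi i v_i; the sum is over the finite
   support. *)
Definition dlift (phi : I -> V -> W) (c : dsum) : W :=
  \sum_(i \in [set: I]%classic) phi i (c i).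

Lemma linear_on0 phi i : linear_on phi -> phi i 0 = 0.
Proof.
move=> pl; have := pl i (-1) 0 0; rewrite rpred0 => /(_ isT isT).
by rewrite scaler0 addr0 scaleN1r addNr.
Qed.

Lemma dliftE phi (c : dsum) (D : {fset I}) : linear_on phi ->
  (forall i, i \notin D -> c i = 0) -> dlift phi c = \sum_(i <- D) phi i (c i).
Proof.
move=> pl cD; rewrite /dlift (fsbigTE D) // => i /cD ->.
exact: linear_on0.
Qed.

Lemma dlift_linear phi : linear_on phi -> linear (dlift phi).
Proof.
move=> pl k c d; have [D cD] := dsum_fin c; have [E dE] := dsum_fin d.
have cDE i : i \notin (D `|` E)%fset -> c i = 0.
  by rewrite inE => /norP[/cD].
have dDE i : i \notin (D `|` E)%fset -> d i = 0.
  by rewrite inE => /norP[_ /dE].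
rewrite !(@dliftE _ _ (D `|` E)%fset) //; last first.
  by move=> i iDE; rewrite -[LHS]/(k *: c i + d i) cDE // dDE // scaler0 addr0.
rewrite scaler_sumr -big_split /=; apply: eq_bigr => i _.
by rewrite -pl ?dval_in.
Qed.

Lemma dlift_single phi i v : linear_on phi -> v \in S i ->
  dlift phi (dsingle i v) = phi i v.
Proof.
move=> pl vS; rewrite (@dliftE _ _ [fset i]%fset) //.
  by rewrite big_seq_fset1 dsingleE // eqxx.
by move=> j; rewrite inE dsingleE // => /negPf->.
Qed.

Lemma dlift0 phi : linear_on phi -> dlift phi 0 = 0.
Proof. by move=> pl; rewrite (@dliftE _ _ fset0) // big_seq_fset0. Qed.

Lemma dliftD phi c d : linear_on phi -> dlift phi (c + d) = dlift phi c + dlift phi d.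
Proof. by move=> pl; rewrite -[c]scale1r dlift_linear // !scale1r. Qed.

Lemma dliftZ phi k c : linear_on phi -> dlift phi (k *: c) = k *: dlift phi c.
Proof. by move=> pl; rewrite -[k *: c]addr0 dlift_linear // dlift0 // addr0. Qed.

Lemma dlift_lin phi psi chi k c : linear_on phi -> linear_on psi -> linear_on chi ->
  (forall i v, v \in S i -> chi i v = k *: phi i v + psi i v) ->
  dlift chi c = k *: dlift phi c + dlift psi c.
Proof.
move=> pl ql rl rE; have [D cD] := dsum_fin c.
rewrite !(@dliftE _ _ D) // scaler_sumr -big_split /=.
by apply: eq_bigr => i _; rewrite rE ?dval_in.
Qed.
End Lift.

Section Mul.
Variable mu : I -> V -> I -> V -> dsum.

Definition dmul (a b : dsum) : dsum :=
  dlift (fun i u => dlift (mu i u) b) a.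

Hypothesis mul_l : forall j v, v \in S j -> linear_on (fun i u => mu i u j v).
Hypothesis mul_r : forall i u, u \in S i -> linear_on (mu i u).

Lemma dmul_on b : linear_on (fun i u => dlift (mu i u) b).
Proof.
move=> i k u v uS vS; apply: dlift_lin; try exact: mul_r.
  by apply: mul_r; rewrite rpredD ?rpredZ.
by move=> j w wS; apply: mul_l.
Qed.

Lemma dmul_ll b : linear (dmul^~ b).
Proof. by apply: dlift_linear; exact: dmul_on. Qed.

Lemma dmul_lr a : linear (dmul a).
Proof.
move=> k c d; apply: dlift_lin; try exact: dmul_on.
by move=> i v vS; apply: dlift_linear; apply: mul_r.
Qed.

Lemma dmulDl : left_distributive dmul +%R.
Proof. by move=> a b c; rewrite -[a]scale1r dmul_ll !scale1r. Qed.
Lemma dmulDr : right_distributive dmul +%R.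
Proof. by move=> a b c; rewrite -[b]scale1r dmul_lr !scale1r. Qed.
Lemma dmul0r b : dmul 0 b = 0.
Proof. by apply: dlift0; exact: dmul_on. Qed.
Lemma dmulr0 a : dmul a 0 = 0.
Proof. by have := dmul_lr a (-1) 0 0; rewrite scaler0 addr0 scaleN1r addNr. Qed.
Lemma dmulAl k a b : k *: dmul a b = dmul (k *: a) b.
Proof. by have := dmul_ll b k a 0; rewrite addr0 dmul0r addr0. Qed.
Lemma dmulAr k a b : k *: dmul a b = dmul a (k *: b).
Proof. by have := dmul_lr a k b 0; rewrite addr0 dmulr0 addr0. Qed.

Lemma dmul_single i u j v : u \in S i -> v \in S j ->
  dmul (dsingle i u) (dsingle j v) = mu i u j v.
Proof.
move=> uS vS; rewrite /dmul dlift_single //; last exact: dmul_on.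
by rewrite dlift_single //; exact: mul_r.
Qed.

Lemma dmulA : (forall i u j v k w, u \in S i -> v \in S j -> w \in S k ->
    dmul (dsingle i u) (mu j v k w) = dmul (mu i u j v) (dsingle k w)) ->
  associative dmul.
Proof.
move=> muA a b c; elim/dsum_ind: a => [|i u a uS IHa]; first by rewrite !dmul0r.
rewrite !dmulDl {}IHa; congr (_ + _).
elim/dsum_ind: b => [|j v b vS IHb]; first by rewrite !(dmul0r, dmulr0).
rewrite !(dmulDl, dmulDr) {}IHb; congr (_ + _).
elim/dsum_ind: c => [|k w c wS IHc]; first by rewrite !dmulr0.
by rewrite !dmulDr {}IHc !(dmul_single _ wS) // dmul_single // muA.
Qed.

Lemma dmul1 e : (forall i u, u \in S i -> dmul e (dsingle i u) = dsingle i u) ->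
  left_id e dmul.
Proof.
move=> e1; elim/dsum_ind => [|i u c uS IH]; first exact: dmulr0.
by rewrite dmulDr IH e1.
Qed.

Lemma dmulr_1 e : (forall i u, u \in S i -> dmul (dsingle i u) e = dsingle i u) ->
  right_id e dmul.
Proof.
move=> e1; elim/dsum_ind => [|i u c uS IH]; first exact: dmul0r.
by rewrite dmulDl IH e1.
Qed.
End Mul.
End DirectSum.

(* A groupoid with finitely many objects. *)
Record groupoid := Groupoid {
  gob : finType;
  gmor :> choiceType;
  gdom : gmor -> gob;
  gran : gmor -> gob;
  gid : gob -> gmor;
  (* only meaningful when gdom g = gran h *)
  gmul : gmor -> gmor -> gmor;
  ginv : gmor -> gmor;
  gdom_id : forall e, gdom (gid e) = e;
  gran_id : forall e, gran (gid e) = e;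
  gdomM : forall g h, gdom g = gran h -> gdom (gmul g h) = gdom h;
  granM : forall g h, gdom g = gran h -> gran (gmul g h) = gran g;
  gmulA : forall g h l, gdom g = gran h -> gdom h = gran l ->
    gmul g (gmul h l) = gmul (gmul g h) l;
  gmul1 : forall g, gmul (gid (gran g)) g = g;
  gmul_1 : forall g, gmul g (gid (gdom g)) = g;
  gdomV : forall g, gdom (ginv g) = gran g;
  granV : forall g, gran (ginv g) = gdom g;
  gmulV : forall g, gmul g (ginv g) = gid (gran g);
  gVmul : forall g, gmul (ginv g) g = gid (gdom g)
}.

(* An action on a finite set: [gset_dom a e] is X_e, and X_g is X_{r(g)}, so
   that X_{g^-1} is X_{d(g)}.  The value of [gact a g] outside X_{d(g)} is
   irrelevant. *)
Record gset (G : groupoid) (X : finType) := GSet {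
  gset_dom : gob G -> {set X};
  gact : G -> X -> X;
  gact_inj : forall g, {in gset_dom (gdom g) &, injective (gact g)};
  gact_im : forall g, gact g @: gset_dom (gdom g) = gset_dom (gran g);
  gact_id : forall e x, x \in gset_dom e -> gact (gid e) x = x;
  gactM : forall g h x, gdom g = gran h -> x \in gset_dom (gdom h) ->
    gact g (gact h x) = gact (gmul g h) x
}.

Definition gset_split (G : groupoid) (X : finType) (a : gset G X) : Prop :=
  (forall x, exists e, x \in gset_dom a e) /\
  (forall e e' x, x \in gset_dom a e -> x \in gset_dom a e' -> e = e').

Definition fully_faithful (G : groupoid) (X : finType) (a : gset G X) : Prop :=
  forall g x, x \in gset_dom a (gran g) :&: gset_dom a (gdom g) ->
    gact a g x = x -> exists e, g = gid e.

Record biset (G K : groupoid) (X : finType) := Biset {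
  lact : gset G X;
  ract : gset K X;
  lact_sub : forall g k,
    gact lact g @: (gset_dom lact (gdom g) :&: gset_dom ract (gran k))
      \subset gset_dom lact (gran g) :&: gset_dom ract (gran k);
  ract_sub : forall g k,
    gact ract k @: (gset_dom lact (gran g) :&: gset_dom ract (gdom k))
      \subset gset_dom lact (gran g) :&: gset_dom ract (gran k);
  lractC : forall g k x,
    x \in gset_dom lact (gdom g) :&: gset_dom ract (gdom k) ->
    gact lact g (gact ract k x) = gact ract k (gact lact g x)
}.

Record grading (F : fieldType) (G : groupoid) (A : algebra F) := Grading {
  gr_comp : G -> submodClosed A;
  (* the sum map from the external direct sum of the A_g to A *)
  gr_sum : bijective (dlift (fun _ a => a) : dsum gr_comp -> A);
  gr_mul : forall g h a b, gdom g = gran h -> a \in gr_comp g -> b \in gr_comp h ->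
    a * b \in gr_comp (gmul g h);
  gr_mul0 : forall g h a b, gdom g <> gran h -> a \in gr_comp g -> b \in gr_comp h ->
    a * b = 0
}.

Section GroupoidTheory.
Variables (G : groupoid) (X : finType) (a : gset G X).
Implicit Types (g h : G) (x y : X).

Lemma gmulVK g h : gdom g = gdom h -> gmul (gmul g (ginv h)) h = g.
Proof.
move=> gh; rewrite -gmulA ?granV ?gdomV //.
by rewrite gVmul -gh gmul_1.
Qed.

Lemma gmul_idl g h : gdom g = gran h -> gmul g h = h -> g = gid (gran h).
Proof.
move=> gh e; have e2 : gmul (gmul g h) (ginv h) = gmul h (ginv h) by rewrite e.
by rewrite -gmulA ?granV // gmulV -gh gmul_1 gh in e2.
Qed.

Lemma gmul_idr g h : gdom g = gran h -> gmul g h = g -> h = gid (gdom g).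
Proof.
move=> gh e; have e2 : gmul (ginv g) (gmul g h) = gmul (ginv g) g by rewrite e.
by rewrite gmulA ?gdomV // gVmul gh gmul1 -gh in e2.
Qed.

Lemma gact_in g x : x \in gset_dom a (gdom g) -> gact a g x \in gset_dom a (gran g).
Proof. by move=> xg; rewrite -gact_im imset_f. Qed.

Lemma gactVK g x : x \in gset_dom a (gdom g) -> gact a (ginv g) (gact a g x) = x.
Proof. by move=> xg; rewrite gactM ?gdomV // gVmul gact_id. Qed.

Lemma gactKV g x : x \in gset_dom a (gran g) -> gact a g (gact a (ginv g) x) = x.
Proof. by move=> xg; rewrite gactM ?granV ?gdomV // gmulV gact_id. Qed.
End GroupoidTheory.

Section GradingTheory.
Variables (F : fieldType) (G : groupoid) (A : algebra F) (gr : grading G A).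

Let idlin : linear_on (gr_comp gr) (fun _ (a : A) => a : alg_lmod A).
Proof. by []. Qed.

Local Notation dtot := (dlift (fun _ a => a) : dsum (gr_comp gr) -> alg_lmod A).

Fact gr_dec_subproof (a : A) : exists c : dsum (gr_comp gr), dtot c = a.
Proof. by have [d _ dK] := gr_sum gr; exists (d a). Qed.

(* The homogeneous components of an element. *)
Definition gr_dec (a : A) : dsum (gr_comp gr) := projT1 (cid (gr_dec_subproof a)).

Lemma gr_decK (a : A) : dtot (gr_dec a) = a.
Proof. exact: projT2 (cid (gr_dec_subproof a)). Qed.

Lemma dtotK c : gr_dec (dtot c) = c.
Proof. by apply: (bij_inj (gr_sum gr)); rewrite gr_decK. Qed.

Lemma gr_dec_linear : linear (gr_dec : alg_lmod A -> dsum (gr_comp gr)).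
Proof.
move=> k a b; apply: (bij_inj (gr_sum gr)).
by rewrite dlift_linear // !gr_decK.
Qed.

Lemma gr_dec_single g a : a \in gr_comp gr g -> gr_dec a = dsingle (gr_comp gr) g a.
Proof. by move=> aS; apply: (bij_inj (gr_sum gr)); rewrite gr_decK dlift_single. Qed.

Lemma gr_dec_sum (J : Type) (s : seq J) (f : J -> A) :
  gr_dec (\sum_(j <- s) f j) = \sum_(j <- s) gr_dec (f j).
Proof.
have D (a b : A) : gr_dec (a + b) = gr_dec a + gr_dec b.
  by have := gr_dec_linear 1 a b; rewrite !scale1r.
apply: (big_morph _ D); have := D 0 0; rewrite addr0 => e.
by apply: (addrI (gr_dec 0)); rewrite -e addr0.
Qed.

(* 1_e: the component of 1_A in A_e. *)
Definition gr_one (e : gob G) : A := gr_dec 1 (gid e).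

Lemma gr_one_in e : gr_one e \in gr_comp gr (gid e).
Proof. exact: dval_in. Qed.

Lemma gr_one_mul h a : a \in gr_comp gr h -> gr_one (gran h) * a = a.
Proof.
move=> ah; have [D cD] := dsum_fin (gr_dec 1).
have e1 : (1 : A) = \sum_(i <- D) gr_dec 1 i.
  by rewrite -[LHS]gr_decK (@dliftE _ _ _ _ _ _ _ D).
have : gr_dec a h = \sum_(i <- D) gr_dec (gr_dec 1 i * a) h.
  by rewrite -dval_sum -gr_dec_sum -mulr_suml -e1 mul1r.
rewrite (gr_dec_single ah) dsingleE // eqxx => ae.
have t i : gr_dec (gr_dec 1 i * a) h =
    if i == gid (gran h) then gr_dec 1 i * a else 0.
  have [ih|ih] := eqVneq (gdom i) (gran h); last first.
    rewrite (gr_mul0 _ (dval_in _ i) ah) ?if_same; last by apply/eqP.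
    by rewrite (gr_dec_single (rpred0 (gr_comp gr h))) dsingle0.
  rewrite (gr_dec_single (gr_mul ih (dval_in _ i) ah)).
  rewrite dsingleE ?gr_mul ?dval_in //.
  have -> : (h == gmul i h) = (i == gid (gran h)) => //.
  by apply/eqP/eqP => [/esym/gmul_idl->|->]; rewrite ?gmul1.
rewrite [RHS]ae; under eq_bigr do rewrite t.
have [hD|hD] := boolP (gid (gran h) \in D).
  rewrite (big_fsetD1 (gid (gran h))) //= eqxx big1_seq ?addr0 // => i /andP[_].
  by rewrite !inE => /andP[/negPf-> _].
rewrite /gr_one cD // mul0r big1_seq // => i /andP[_ iD]; case: eqP => // ih.
by rewrite ih (negPf hD) in iD.
Qed.

Lemma gr_mul_one h a : a \in gr_comp gr h -> a * gr_one (gdom h) = a.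
Proof.
move=> ah; have [D cD] := dsum_fin (gr_dec 1).
have e1 : (1 : A) = \sum_(i <- D) gr_dec 1 i.
  by rewrite -[LHS]gr_decK (@dliftE _ _ _ _ _ _ _ D).
have : gr_dec a h = \sum_(i <- D) gr_dec (a * gr_dec 1 i) h.
  by rewrite -dval_sum -gr_dec_sum -mulr_sumr -e1 mulr1.
rewrite (gr_dec_single ah) dsingleE // eqxx => ae.
have t i : gr_dec (a * gr_dec 1 i) h =
    if i == gid (gdom h) then a * gr_dec 1 i else 0.
  have [ih|ih] := eqVneq (gdom h) (gran i); last first.
    rewrite (gr_mul0 _ ah (dval_in _ i)) ?if_same; last by apply/eqP.
    by rewrite (gr_dec_single (rpred0 (gr_comp gr h))) dsingle0.
  rewrite (gr_dec_single (gr_mul ih ah (dval_in _ i))).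
  rewrite dsingleE ?gr_mul ?dval_in //.
  have -> : (h == gmul h i) = (i == gid (gdom h)) => //.
  by apply/eqP/eqP => [/esym/gmul_idr->|->]; rewrite ?gmul_1.
rewrite [RHS]ae; under eq_bigr do rewrite t.
have [hD|hD] := boolP (gid (gdom h) \in D).
  rewrite (big_fsetD1 (gid (gdom h))) //= eqxx big1_seq ?addr0 // => i /andP[_].
  by rewrite !inE => /andP[/negPf-> _].
rewrite /gr_one cD // mulr0 big1_seq // => i /andP[_ iD]; case: eqP => // ih.
by rewrite ih (negPf hD) in iD.
Qed.
End GradingTheory.

Section ZeroSubmodule.
Variables (F : fieldType) (V : lmodType F).
Definition submod0 : {pred V} := pred1 0.
Fact submod0_closed : submod_closed submod0.
Proof.
by split=> [|k u v /eqP-> /eqP->]; rewrite !inE // scaler0 addr0.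
Qed.
HB.instance Definition _ := GRing.isSubmodClosed.Build F V submod0 submod0_closed.
End ZeroSubmodule.

Section Smash.
Variables (F : fieldType) (G : groupoid) (A : algebra F) (gr : grading G A).
Variables (X : finType) (a : gset G X).

Local Notation I := (gmor G * X)%type.

(* The coefficient space of delta_x in degree g: A_g if x is in X_{d(g)}, and 0
   otherwise, so that [dsum smash_comp] is the sum over g in G and
   x in X_{d(g)}. *)
Definition smash_comp (i : I) : submodClosed A :=
  if i.2 \in gset_dom a (gdom i.1) then gr_comp gr i.1 else @submod0 F A.

Local Notation sd := (dsingle smash_comp).

Definition smash_mu (i : I) (u : A) (j : I) (v : A) : dsum smash_comp :=
  if (gdom i.1 == gran j.1) && (gact a j.1 j.2 == i.2)
  then sd (gmul i.1 j.1, j.2) (u * v) else 0.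

Lemma smash_comp_in g x u : x \in gset_dom a (gdom g) ->
  (u \in smash_comp (g, x)) = (u \in gr_comp gr g).
Proof. by rewrite /smash_comp /= => ->. Qed.

Lemma smash_comp_out g x u : x \notin gset_dom a (gdom g) ->
  u \in smash_comp (g, x) -> u = 0.
Proof. by rewrite /smash_comp /= => /negPf-> /eqP. Qed.

Lemma smash_comp_gr i u : u \in smash_comp i -> u \in gr_comp gr i.1.
Proof.
by rewrite /smash_comp; case: ifP => // _ /eqP->; exact: rpred0.
Qed.

Lemma smash_comp_single g x k u v : u \in gr_comp gr g -> v \in gr_comp gr g ->
  sd (g, x) (k *: u + v) = k *: sd (g, x) u + sd (g, x) v.
Proof.
move=> ug vg; have [xg|xg] := boolP (x \in gset_dom a (gdom g)).
  by apply: dsingle_linear; rewrite smash_comp_in.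
have z w : sd (g, x) w = 0.
  apply/dsumP => j /=; rewrite /dsingle_fun; case: ifP => //.
  by case/andP => _ /(smash_comp_out xg).
by rewrite !z scaler0 addr0.
Qed.

Lemma smash_mu_in i u j v : gdom i.1 = gran j.1 ->
  u \in smash_comp i -> v \in smash_comp j ->
  u * v \in smash_comp (gmul i.1 j.1, j.2).
Proof.
case: i j => [g x] [h y] /= gh ug vh.
have [yh|yh] := boolP (y \in gset_dom a (gdom h)).
  rewrite smash_comp_in ?gdomM // gr_mul ?(smash_comp_gr ug) //.
  by rewrite (smash_comp_gr vh).
by rewrite (smash_comp_out yh vh) mulr0 rpred0.
Qed.

Lemma smash_mu_in2 g x u h y v : gdom g = gran h ->
  u \in smash_comp (g, x) -> v \in smash_comp (h, y) ->
  u * v \in smash_comp (gmul g h, y).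
Proof. exact: (@smash_mu_in (g, x) u (h, y) v). Qed.

Lemma smash_mu_l j v : v \in smash_comp j ->
  linear_on smash_comp (fun i u => smash_mu i u j v).
Proof.
move=> vj i k u u' ui ui'; rewrite /smash_mu.
case: ifP => [/andP[/eqP gh _]|_]; last by rewrite scaler0 addr0.
by rewrite mulrDl -algAl dsingle_linear // smash_mu_in.
Qed.

Lemma smash_mu_r i u : u \in smash_comp i -> linear_on smash_comp (smash_mu i u).
Proof.
move=> ui j k v v' vj vj'; rewrite /smash_mu.
case: ifP => [/andP[/eqP gh _]|_]; last by rewrite scaler0 addr0.
by rewrite mulrDr -algAr dsingle_linear // smash_mu_in.
Qed.

Local Notation smul := (dmul smash_mu).

Lemma smul_single i u j v : u \in smash_comp i -> v \in smash_comp j ->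
  smul (sd i u) (sd j v) = smash_mu i u j v.
Proof. exact: dmul_single smash_mu_l smash_mu_r _ _ _ _. Qed.

Lemma smash_mulA : associative smul.
Proof.
apply: (dmulA smash_mu_l smash_mu_r) => i u j v k w ui vj wk.
case: i j k ui vj wk => [g x] [h y] [l z] ui vj wk.
have [zl|zl] := boolP (z \in gset_dom a (gdom l)); last first.
  rewrite (smash_comp_out zl wk) dsingle0 (dmulr0 smash_mu_l smash_mu_r).
  by rewrite /smash_mu mulr0 dsingle0 if_same (dmulr0 smash_mu_l smash_mu_r).
rewrite {2 4}/smash_mu /=; case: ifP => [/andP[/eqP hl /eqP lz]|hl]; last first.
  rewrite (dmulr0 smash_mu_l smash_mu_r); case: ifP => [/andP[/eqP gh _]|_].
    by rewrite smul_single ?(smash_mu_in2 gh ui) // /smash_mu /= gdomM // hl.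
  by rewrite (dmul0r smash_mu_l smash_mu_r).
rewrite smul_single ?(smash_mu_in2 hl vj) // /smash_mu /= granM // -gactM // lz.
case: ifP => [/andP[/eqP gh hy]|_]; last by rewrite (dmul0r smash_mu_l smash_mu_r).
rewrite smul_single ?(smash_mu_in2 gh ui) // /smash_mu /= gdomM // hl lz !eqxx /=.
by rewrite gmulA // mulrA.
Qed.

Definition smash_one : dsum smash_comp :=
  \sum_(e : gob G) \sum_(x in gset_dom a e) sd (gid e, x) (gr_one gr e).

Lemma sone_in e x : x \in gset_dom a e -> gr_one gr e \in smash_comp (gid e, x).
Proof. by move=> xe; rewrite smash_comp_in ?gdom_id // gr_one_in. Qed.

Lemma smash_mul1 : left_id smash_one smul.
Proof.
apply: (dmul1 smash_mu_l smash_mu_r) => -[h y] v vj.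
have D := dmulDl smash_mu_l smash_mu_r; have Z := dmul0r smash_mu_l smash_mu_r.
rewrite /smash_one (big_morph (smul^~ _) (fun b c => D b c _) (Z _)).
under eq_bigr do rewrite (big_morph (smul^~ _) (fun b c => D b c _) (Z _)).
have [yh|yh] := boolP (y \in gset_dom a (gdom h)); last first.
  rewrite (smash_comp_out yh vj) dsingle0 big1 // => e _; rewrite big1 // => x _.
  exact: dmulr0 smash_mu_l smash_mu_r _.
rewrite (bigD1 (gran h)) //= [X in _ + X]big1 ?addr0; last first.
  move=> e eh; rewrite big1 // => x xe.
  by rewrite smul_single ?sone_in // /smash_mu /= gdom_id (negPf eh).
rewrite (bigD1 (gact a h y)) ?gact_in //= [X in _ + X]big1 ?addr0; last first.
  move=> x /andP[xe xn].
  by rewrite smul_single ?sone_in // /smash_mu /= [_ == x]eq_sym (negPf xn) andbF.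
rewrite smul_single ?sone_in ?gact_in // /smash_mu /= gdom_id !eqxx /= gmul1.
by rewrite gr_one_mul // (smash_comp_gr vj).
Qed.

Lemma smash_mul_1 : right_id smash_one smul.
Proof.
apply: (dmulr_1 smash_mu_l smash_mu_r) => -[h y] v vj.
have D := dmulDr smash_mu_l smash_mu_r; have Z := dmulr0 smash_mu_l smash_mu_r.
rewrite /smash_one (big_morph (smul _) (D _) (Z _)).
under eq_bigr do rewrite (big_morph (smul _) (D _) (Z _)).
have [yh|yh] := boolP (y \in gset_dom a (gdom h)); last first.
  rewrite (smash_comp_out yh vj) dsingle0 big1 // => e _; rewrite big1 // => x _.
  exact: dmul0r smash_mu_l smash_mu_r _.
rewrite (bigD1 (gdom h)) //= [X in _ + X]big1 ?addr0; last first.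
  move=> e eh; rewrite big1 // => x xe.
  by rewrite smul_single ?sone_in // /smash_mu /= gran_id eq_sym (negPf eh).
rewrite (bigD1 y) //= [X in _ + X]big1 ?addr0; last first.
  move=> x /andP[xe xn].
  by rewrite smul_single ?sone_in // /smash_mu /= gact_id // (negPf xn) andbF.
rewrite smul_single ?sone_in // /smash_mu /= gran_id gact_id // !eqxx /= gmul_1.
by rewrite gr_mul_one // (smash_comp_gr vj).
Qed.

Definition smash : algebra F := Algebra smash_mulA smash_mul1 smash_mul_1
  (dmulDl smash_mu_l smash_mu_r) (dmulDr smash_mu_l smash_mu_r)
  (dmulAl smash_mu_l smash_mu_r) (dmulAr smash_mu_l smash_mu_r).

(* a_g delta_x *)
Definition sdelta (g : G) (x : X) (u : A) : smash := sd (g, x) u.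

Lemma sdeltaM g x u h y v : u \in smash_comp (g, x) -> v \in smash_comp (h, y) ->
  sdelta g x u * sdelta h y v =
  if (gdom g == gran h) && (gact a h y == x) then sdelta (gmul g h) y (u * v) else 0.
Proof. exact: smul_single. Qed.

Lemma smash_ind (P : smash -> Prop) : P 0 ->
  (forall g x u c, u \in smash_comp (g, x) -> P c -> P (sdelta g x u + c)) ->
  forall c, P c.
Proof. by move=> P0 PD; apply: dsum_ind => // -[g x]; exact: PD. Qed.

Lemma smash_oneE :
  1 = \sum_(e : gob G) \sum_(x in gset_dom a e) sdelta (gid e) x (gr_one gr e).
Proof. by []. Qed.
End Smash.

Record gaction (F : fieldType) (K : groupoid) (B : algebra F) := GAction {
  (* E_p; E_k is E_{r(k)} and E_{k^-1} is E_{d(k)} *)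
  ga_dom : gob K -> submodClosed B;
  ga_act : K -> B -> B;
  ga_ideal : forall p b x, x \in ga_dom p -> b * x \in ga_dom p /\ x * b \in ga_dom p;
  ga_linear : forall k (c : F) x y, x \in ga_dom (gdom k) -> y \in ga_dom (gdom k) ->
    ga_act k (c *: x + y) = c *: ga_act k x + ga_act k y;
  ga_mul : forall k x y, x \in ga_dom (gdom k) -> y \in ga_dom (gdom k) ->
    ga_act k (x * y) = ga_act k x * ga_act k y;
  ga_inj : forall k, {in ga_dom (gdom k) &, injective (ga_act k)};
  ga_im : forall k y,
    y \in ga_dom (gran k) <-> exists2 x, x \in ga_dom (gdom k) & y = ga_act k x;
  ga_id : forall p x, x \in ga_dom p -> ga_act (gid p) x = x;
  gaM : forall k l x, gdom k = gran l -> x \in ga_dom (gdom l) ->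
    ga_act (gmul k l) x = ga_act k (ga_act l x)
}.

(* An action whose ideals E_p are unital algebras; this makes the skew groupoid
   ring unital, with identity the sum of the 1_p delta_p. *)
Record ugaction (F : fieldType) (K : groupoid) (B : algebra F) := UGAction {
  ugact :> gaction K B;
  uga_one : gob K -> B;
  uga_one_in : forall p, uga_one p \in ga_dom ugact p;
  uga_mul1 : forall p x, x \in ga_dom ugact p -> uga_one p * x = x;
  uga_mul_1 : forall p x, x \in ga_dom ugact p -> x * uga_one p = x
}.

Section Skew.
Variables (F : fieldType) (K : groupoid) (B : algebra F) (c : ugaction K B).

Definition skew_comp (k : K) : submodClosed B := ga_dom c (gran k).

Local Notation sd := (dsingle skew_comp).

Definition skew_mu (k : K) (x : B) (l : K) (y : B) : dsum skew_comp :=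
  if gdom k == gran l then sd (gmul k l) (x * ga_act c k y) else 0.

Lemma ga_in k x : x \in ga_dom c (gdom k) -> ga_act c k x \in ga_dom c (gran k).
Proof. by move=> xk; apply/ga_im; exists x. Qed.

Lemma skew_mu_in k x l y : gdom k = gran l -> x \in skew_comp k ->
  y \in skew_comp l -> x * ga_act c k y \in skew_comp (gmul k l).
Proof.
move=> kl xk _; rewrite /skew_comp granM //.
by have [] := ga_ideal (ga_act c k y) xk.
Qed.

Lemma skew_mu_l l y : y \in skew_comp l ->
  linear_on skew_comp (fun k x => skew_mu k x l y).
Proof.
move=> yl k a x x' xk xk'; rewrite /skew_mu.
case: eqP => [kl|_]; last by rewrite scaler0 addr0.
by rewrite mulrDl -algAl dsingle_linear // skew_mu_in.
Qed.

Lemma skew_mu_r k x : x \in skew_comp k -> linear_on skew_comp (skew_mu k x).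
Proof.
move=> xk l a y y' yl yl'; rewrite /skew_mu.
case: eqP => [kl|_]; last by rewrite scaler0 addr0.
have e := ga_linear a (x := y) (y := y').
by rewrite e ?kl // mulrDr -algAr dsingle_linear // skew_mu_in.
Qed.

Local Notation smul := (dmul skew_mu).

Lemma kmul_single k x l y : x \in skew_comp k -> y \in skew_comp l ->
  smul (sd k x) (sd l y) = skew_mu k x l y.
Proof. exact: dmul_single skew_mu_l skew_mu_r _ _ _ _. Qed.

Lemma skew_mulA : associative smul.
Proof.
apply: (dmulA skew_mu_l skew_mu_r) => k x l y m z xk yl zm.
rewrite {2 4}/skew_mu; have [lm|lm] := eqVneq (gdom l) (gran m); last first.
  rewrite (dmulr0 skew_mu_l skew_mu_r); case: eqP => [kl|_].
    by rewrite kmul_single ?(skew_mu_in kl xk yl) // /skew_mu gdomM // (negPf lm).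
  by rewrite (dmul0r skew_mu_l skew_mu_r).
rewrite kmul_single ?(skew_mu_in lm yl zm) // /skew_mu granM //.
case: eqP => [kl|_]; last by rewrite (dmul0r skew_mu_l skew_mu_r).
rewrite kmul_single ?(skew_mu_in kl xk yl) // /skew_mu gdomM // lm eqxx gmulA //.
have zl : z \in ga_dom c (gdom l) by rewrite lm.
by rewrite gaM // -mulrA ga_mul // kl // ga_in.
Qed.

Definition skew_one : dsum skew_comp := \sum_(p : gob K) sd (gid p) (uga_one c p).

Lemma kone_in p : uga_one c p \in skew_comp (gid p).
Proof. by rewrite /skew_comp gran_id uga_one_in. Qed.

Lemma skew_mul1 : left_id skew_one smul.
Proof.
apply: (dmul1 skew_mu_l skew_mu_r) => l y yl.
have D := dmulDl skew_mu_l skew_mu_r; have Z := dmul0r skew_mu_l skew_mu_r.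
rewrite /skew_one (big_morph (smul^~ _) (fun b c => D b c _) (Z _)).
rewrite (bigD1 (gran l)) //= [X in _ + X]big1 ?addr0; last first.
  by move=> p pl; rewrite kmul_single ?kone_in // /skew_mu gdom_id (negPf pl).
rewrite kmul_single ?kone_in // /skew_mu gdom_id eqxx gmul1.
by rewrite ga_id // uga_mul1.
Qed.

Lemma ga_act_one k x : x \in ga_dom c (gran k) ->
  x * ga_act c k (uga_one c (gdom k)) = x.
Proof.
case/ga_im => y yk ->.
by rewrite -ga_mul ?uga_one_in // uga_mul_1.
Qed.

Lemma skew_mul_1 : right_id skew_one smul.
Proof.
apply: (dmulr_1 skew_mu_l skew_mu_r) => k x xk.
have D := dmulDr skew_mu_l skew_mu_r; have Z := dmulr0 skew_mu_l skew_mu_r.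
rewrite /skew_one (big_morph (smul _) (D _) (Z _)).
rewrite (bigD1 (gdom k)) //= [X in _ + X]big1 ?addr0; last first.
  move=> p pk; rewrite kmul_single ?kone_in // /skew_mu gran_id.
  by rewrite eq_sym (negPf pk).
rewrite kmul_single ?kone_in // /skew_mu gran_id eqxx gmul_1.
by rewrite ga_act_one.
Qed.

Definition skew_ring : algebra F := Algebra skew_mulA skew_mul1 skew_mul_1
  (dmulDl skew_mu_l skew_mu_r) (dmulDr skew_mu_l skew_mu_r)
  (dmulAl skew_mu_l skew_mu_r) (dmulAr skew_mu_l skew_mu_r).

(* x delta_k *)
Definition kdelta (k : K) (x : B) : skew_ring := sd k x.

Lemma kdeltaM k x l y : x \in ga_dom c (gran k) -> y \in ga_dom c (gran l) ->
  kdelta k x * kdelta l y =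
  if gdom k == gran l then kdelta (gmul k l) (x * ga_act c k y) else 0.
Proof. exact: kmul_single. Qed.

Lemma skew_oneE : 1 = \sum_(p : gob K) kdelta (gid p) (uga_one c p).
Proof. by []. Qed.
End Skew.

Section BisetTheory.
Variables (G K : groupoid) (X : finType) (ab : biset G K X).
Local Notation al := (lact ab).
Local Notation be := (ract ab).

Lemma lact_in g p x : x \in gset_dom al (gdom g) -> x \in gset_dom be p ->
  gact al g x \in gset_dom be p.
Proof.
move=> xg xp.
suff : gact al g x \in gset_dom al (gran g) :&: gset_dom be (gran (gid p)).
  by rewrite inE gran_id => /andP[].
by apply: (fintype.subsetP (lact_sub ab g (gid p))); rewrite imset_f // inE xg gran_id.
Qed.

Lemma ract_in k e x : x \in gset_dom be (gdom k) -> x \in gset_dom al e ->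
  gact be k x \in gset_dom al e.
Proof.
move=> xk xe.
suff : gact be k x \in gset_dom al (gran (gid e)) :&: gset_dom be (gran k).
  by rewrite inE gran_id => /andP[].
by apply: (fintype.subsetP (ract_sub ab (gid e) k)); rewrite imset_f // inE xk gran_id xe.
Qed.

Lemma lact_inE g p x : x \in gset_dom al (gdom g) ->
  (gact al g x \in gset_dom be p) = (x \in gset_dom be p).
Proof.
move=> xg; apply/idP/idP => [h|]; last exact: lact_in.
by rewrite -(gactVK xg) lact_in // gdomV gact_in.
Qed.

Lemma ract_inE k e x : x \in gset_dom be (gdom k) ->
  (gact be k x \in gset_dom al e) = (x \in gset_dom al e).
Proof.
move=> xk; apply/idP/idP => [h|]; last exact: ract_in.
by rewrite -(gactVK xk) ract_in // gdomV gact_in.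
Qed.

Lemma lractE g k x : x \in gset_dom al (gdom g) -> x \in gset_dom be (gdom k) ->
  gact al g (gact be k x) = gact be k (gact al g x).
Proof. by move=> xg xk; apply: lractC; rewrite inE xg. Qed.
End BisetTheory.

Section SmashAction.
Variables (F : fieldType) (G K : groupoid) (A : algebra F) (gr : grading G A).
Variables (X : finType) (ab : biset G K X).
Local Notation al := (lact ab).
Local Notation be := (ract ab).
Local Notation B := (smash gr al).
Local Notation C := (smash_comp gr al).

Implicit Types c d : B.

Definition sact_pred (p : gob K) : {pred B} := fun c =>
  `[< forall g x, x \notin gset_dom be p -> dval c (g, x) = 0 >].

Fact sact_closed p : submod_closed (sact_pred p).
Proof.
split=> [|k c d /asboolP ce /asboolP de]; apply/asboolP=> // g x xp.
rewrite -[LHS]/(k *: dval c (g, x) + dval d (g, x)).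
by rewrite ce // de // scaler0 addr0.
Qed.
HB.instance Definition _ p :=
  GRing.isSubmodClosed.Build F B (sact_pred p) (sact_closed p).

(* E_p, the sum of the A_g delta_x with x in Y_p and X_{d(g)} *)
Definition sact_dom (p : gob K) : submodClosed B := sact_pred p.

(* gamma_k (a_g delta_x) = a_g delta_{beta_k(x)}; only meaningful on E_{k^-1} *)
Definition sact (k : K) : B -> B :=
  dlift (fun i u => sdelta gr al i.1 (gact be k i.2) u : dsum C).

Definition sact_one (p : gob K) : B :=
  \sum_(e : gob G) \sum_(x in gset_dom al e :&: gset_dom be p)
    sdelta gr al (gid e) x (gr_one gr e).

Lemma sact_dom_single p g x u : u \in C (g, x) -> x \in gset_dom be p ->
  sdelta gr al g x u \in sact_dom p.
Proof.
move=> ug xp; apply/asboolP => h y yp; rewrite dsingleE //.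
by case: eqP => // -[_ yx]; rewrite yx xp in yp.
Qed.

Lemma sact_dom_ind p (P : B -> Prop) : P 0 ->
  (forall g x u c, u \in C (g, x) -> x \in gset_dom be p -> P c ->
     P (sdelta gr al g x u + c)) -> forall c, c \in sact_dom p -> P c.
Proof.
move=> P0 PD c /asboolP cp; have [D /dsum_expand e] := dsum_fin c.
rewrite [c]e; elim/big_rec: _ => // -[g x] d _ Pd.
have [xp|xp] := boolP (x \in gset_dom be p); first by apply: PD => //; exact: dval_in.
by rewrite cp // dsingle0 add0r.
Qed.

Lemma sact_on k : linear_on C (fun i u => sdelta gr al i.1 (gact be k i.2) u : dsum C).
Proof.
by move=> [g x] a u v ug vg; apply: smash_comp_single;
  [exact: smash_comp_gr ug | exact: smash_comp_gr vg].
Qed.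

Lemma sact_linear k : linear (sact k). Proof. exact: dlift_linear (sact_on k). Qed.

Lemma sactD k c d : sact k (c + d) = sact k c + sact k d.
Proof. exact: (dliftD _ _ (sact_on k)). Qed.

Lemma sact0 k : sact k 0 = 0. Proof. exact: dlift0 (sact_on k). Qed.

Lemma sact_sdelta k g x u : u \in C (g, x) ->
  sact k (sdelta gr al g x u) = sdelta gr al g (gact be k x) u.
Proof. by move=> ug; rewrite [LHS](dlift_single (sact_on k)). Qed.

Lemma sact_comp k g x u : x \in gset_dom be (gdom k) ->
  (u \in C (g, gact be k x)) = (u \in C (g, x)).
Proof. by move=> xk; rewrite /smash_comp /= ract_inE. Qed.

Fact sact_ideal p b c : c \in sact_dom p -> b * c \in sact_dom p /\ c * b \in sact_dom p.
Proof.
move: c; apply: sact_dom_ind => [|g x u c ug xp [IH1 IH2]].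
  by rewrite mulr0 mul0r rpred0.
rewrite mulrDl mulrDr; split; apply: rpredD => //.
  elim/smash_ind: b {IH1 IH2} => [|h y v b vh IH]; first by rewrite mul0r rpred0.
  rewrite mulrDl rpredD // sdeltaM //; case: ifP => [/andP[/eqP hg /eqP yx]|_].
    by rewrite sact_dom_single // (smash_mu_in2 hg vh ug).
  exact: rpred0.
elim/smash_ind: b {IH1 IH2} => [|h y v b vh IH]; first by rewrite mulr0 rpred0.
rewrite mulrDr rpredD // sdeltaM //; case: ifP => [/andP[/eqP hg /eqP yx]|_].
  have [yh|yh] := boolP (y \in gset_dom al (gdom h)).
    by rewrite sact_dom_single ?(smash_mu_in2 hg ug vh) // -(lact_inE _ yh) yx.
  by rewrite (smash_comp_out yh vh) mulr0 /sdelta dsingle0 rpred0.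
exact: rpred0.
Qed.

Fact sact_lin k (a : F) c d : c \in sact_dom (gdom k) -> d \in sact_dom (gdom k) ->
  sact k (a *: c + d) = a *: sact k c + sact k d.
Proof. by move=> _ _; exact: sact_linear. Qed.

Fact sact_mul k c d : c \in sact_dom (gdom k) -> d \in sact_dom (gdom k) ->
  sact k (c * d) = sact k c * sact k d.
Proof.
move=> ck dk; move: c ck; apply: sact_dom_ind => [|g x u c ug xk IHc].
  by rewrite sact0 !mul0r sact0.
rewrite mulrDl !sactD mulrDl {}IHc; congr (_ + _).
move: d dk; apply: sact_dom_ind => [|h y v d vh yk IHd].
  by rewrite sact0 !mulr0 sact0.
rewrite mulrDr !sactD mulrDr {}IHd; congr (_ + _).
rewrite !sact_sdelta // !sdeltaM ?sact_comp //.
have [yh|yh] := boolP (y \in gset_dom al (gdom h)); last first.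
  by rewrite (smash_comp_out yh vh) mulr0 /sdelta !dsingle0 !if_same sact0.
rewrite lractE //.
have -> : (gact be k (gact al h y) == gact be k x) = (gact al h y == x).
  by apply/eqP/eqP => [/gact_inj-> //|->] //; rewrite lact_in.
case: ifP => [/andP[/eqP gh _]|_]; last by rewrite sact0.
by rewrite sact_sdelta // (smash_mu_in2 gh ug vh).
Qed.

Lemma sactVK k c : c \in sact_dom (gdom k) -> sact (ginv k) (sact k c) = c.
Proof.
move: c; apply: sact_dom_ind => [|g x u c ug xk IH]; first by rewrite !sact0.
by rewrite !sactD IH !sact_sdelta ?sact_comp // gactVK.
Qed.

Lemma sactKV k c : c \in sact_dom (gran k) -> sact k (sact (ginv k) c) = c.
Proof.
move: c; apply: sact_dom_ind => [|g x u c ug xk IH]; first by rewrite !sact0.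
by rewrite !sactD IH !sact_sdelta ?sact_comp ?gdomV // gactKV.
Qed.

Lemma sact_in k c : c \in sact_dom (gdom k) -> sact k c \in sact_dom (gran k).
Proof.
move: c; apply: sact_dom_ind => [|g x u c ug xk IH]; first by rewrite sact0 rpred0.
by rewrite sactD rpredD // sact_sdelta // sact_dom_single ?sact_comp // gact_in.
Qed.

Fact sact_inj k : {in sact_dom (gdom k) &, injective (sact k)}.
Proof. by move=> c d ck dk e; rewrite -(sactVK ck) e sactVK. Qed.

Fact sact_im k d : d \in sact_dom (gran k) <->
  exists2 c, c \in sact_dom (gdom k) & d = sact k c.
Proof.
split=> [dk|[c ck ->]]; last exact: sact_in.
exists (sact (ginv k) d); last by rewrite sactKV.
by have := @sact_in (ginv k) d; rewrite gdomV granV; apply.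
Qed.

Fact sact_id p c : c \in sact_dom p -> sact (gid p) c = c.
Proof.
move: c; apply: sact_dom_ind => [|g x u c ug xk IH]; first by rewrite sact0.
by rewrite sactD IH sact_sdelta // gact_id.
Qed.

Fact sactM k l c : gdom k = gran l -> c \in sact_dom (gdom l) ->
  sact (gmul k l) c = sact k (sact l c).
Proof.
move=> kl; move: c; apply: sact_dom_ind => [|g x u c ug xk IH]; first by rewrite !sact0.
by rewrite !sactD IH !sact_sdelta ?sact_comp // gactM.
Qed.

Definition smash_gaction : gaction K B := GAction sact_ideal sact_lin sact_mul
  sact_inj sact_im sact_id sactM.

Fact sact_one_in p : sact_one p \in sact_dom p.
Proof.
rewrite /sact_one rpred_sum // => e _; rewrite rpred_sum // => x.
by rewrite inE => /andP[xe xp]; rewrite sact_dom_single // sone_in.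
Qed.

Fact sact_mul1 p c : c \in sact_dom p -> sact_one p * c = c.
Proof.
move: c; apply: sact_dom_ind => [|h y v c vh yp IH]; first by rewrite mulr0.
rewrite mulrDr IH; congr (_ + _); rewrite /sact_one mulr_suml.
under eq_bigr do rewrite mulr_suml.
have [yh|yh] := boolP (y \in gset_dom al (gdom h)); last first.
  rewrite (smash_comp_out yh vh) /sdelta dsingle0 big1 // => e _.
  by rewrite big1 // => x _; rewrite mulr0.
rewrite (bigD1 (gran h)) //= [X in _ + X]big1 ?addr0; last first.
  move=> e eh; rewrite big1 // => x; rewrite inE => /andP[xe _].
  by rewrite sdeltaM ?sone_in // gdom_id (negPf eh).
rewrite (bigD1 (gact al h y)) ?inE ?gact_in ?lact_in //= [X in _ + X]big1 ?addr0.
  rewrite sdeltaM ?sone_in ?gact_in // gdom_id !eqxx /= gmul1.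
  by rewrite gr_one_mul // (smash_comp_gr vh).
move=> x; rewrite inE => /andP[/andP[xe _] xn].
by rewrite sdeltaM ?sone_in // [_ == x]eq_sym (negPf xn) andbF.
Qed.

Fact sact_mul_1 p c : c \in sact_dom p -> c * sact_one p = c.
Proof.
move: c; apply: sact_dom_ind => [|h y v c vh yp IH]; first by rewrite mul0r.
rewrite mulrDl IH; congr (_ + _); rewrite /sact_one mulr_sumr.
under eq_bigr do rewrite mulr_sumr.
have [yh|yh] := boolP (y \in gset_dom al (gdom h)); last first.
  rewrite (smash_comp_out yh vh) /sdelta dsingle0 big1 // => e _.
  by rewrite big1 // => x _; rewrite mul0r.
rewrite (bigD1 (gdom h)) //= [X in _ + X]big1 ?addr0; last first.
  move=> e eh; rewrite big1 // => x; rewrite inE => /andP[xe _].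
  by rewrite sdeltaM ?sone_in // gran_id eq_sym (negPf eh).
rewrite (bigD1 y) ?inE ?yh //= [X in _ + X]big1 ?addr0.
  rewrite sdeltaM ?sone_in // gran_id gact_id // !eqxx /= gmul_1.
  by rewrite gr_mul_one // (smash_comp_gr vh).
move=> x; rewrite inE => /andP[/andP[xe _] xn].
by rewrite sdeltaM ?sone_in // gact_id // (negPf xn) andbF.
Qed.

Definition smash_action : ugaction K B :=
  @UGAction _ _ _ smash_gaction sact_one sact_one_in sact_mul1 sact_mul_1.
End SmashAction.

Section Orbits.
Variables (G K : groupoid) (X : finType) (ab : biset G K X).
Local Notation al := (lact ab).
Local Notation be := (ract ab).

(* When the K-action is split, x lies in a single Y_p, and k ranges over D_p. *)
Definition orbit_set (x : X) : {set X} :=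
  [set y | `[< exists2 k : K, x \in gset_dom be (gdom k) & y = gact be k x >]].

Definition orbits : finType := {w : {set X} | w \in [set orbit_set x | x : X]}.

Definition orbit_of (x : X) : orbits := Sub (orbit_set x) (imset_f _ isT).

Lemma in_orbit x y : reflect (exists2 k : K, x \in gset_dom be (gdom k) & y = gact be k x)
  (y \in orbit_set x).
Proof. by rewrite inE; exact: asboolP. Qed.

Lemma orbit_of_eq x y : orbit_of x = orbit_of y <-> orbit_set x = orbit_set y.
Proof. by split=> [[]|e] //; apply: val_inj. Qed.

Lemma orbit_act g x x' : x \in gset_dom al (gdom g) -> x' \in gset_dom al (gdom g) ->
  orbit_of x = orbit_of x' -> orbit_of (gact al g x) = orbit_of (gact al g x').
Proof.
move=> xg x'g /orbit_of_eq xx'; apply/orbit_of_eq.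
suff sub z z' : z \in gset_dom al (gdom g) -> z' \in gset_dom al (gdom g) ->
    orbit_set z = orbit_set z' ->
    orbit_set (gact al g z) \subset orbit_set (gact al g z').
  by apply/eqP; rewrite finset.eqEsubset !sub.
move=> zg z'g zz'; apply/fintype.subsetP => y /in_orbit[k]; rewrite lact_inE // => zk ->.
have : gact be k z \in orbit_set z' by rewrite -zz'; apply/in_orbit; exists k.
case/in_orbit => l z'l e; apply/in_orbit; exists l; first by rewrite lact_inE.
by rewrite -!lractE // e.
Qed.

Definition orbit_dom (e : gob G) : {set orbits} := orbit_of @: gset_dom al e.

(* lambda_g(o(x)) = o(alpha_g(x)) for x in X_{g^-1}; see orbit_gactE. *)
Definition orbit_gact (g : G) (w : orbits) : orbits :=
  if [pick x | (x \in gset_dom al (gdom g)) && (orbit_of x == w)] is Some x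
  then orbit_of (gact al g x) else w.

Lemma orbit_gactE g x : x \in gset_dom al (gdom g) ->
  orbit_gact g (orbit_of x) = orbit_of (gact al g x).
Proof.
move=> xg; rewrite /orbit_gact; case: pickP => [y /andP[yg /eqP yx]|/(_ x)].
  exact: orbit_act.
by rewrite xg eqxx.
Qed.

Fact orbit_inj g : {in orbit_dom (gdom g) &, injective (orbit_gact g)}.
Proof.
move=> _ _ /imsetP[x xg ->] /imsetP[y yg ->]; rewrite !orbit_gactE // => e.
rewrite -(gactVK xg) -(gactVK yg); apply: orbit_act => //;
  by rewrite gdomV gact_in.
Qed.

Fact orbit_im g : orbit_gact g @: orbit_dom (gdom g) = orbit_dom (gran g).
Proof.
apply/finset.setP => w; apply/imsetP/imsetP => [[_ /imsetP[x xg ->] ->]|[x xg ->]].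
  by exists (gact al g x); rewrite ?gact_in // orbit_gactE.
have xg' : gact al (ginv g) x \in gset_dom al (gdom g).
  by rewrite -granV gact_in // gdomV.
exists (orbit_of (gact al (ginv g) x)); first exact: imset_f.
by rewrite orbit_gactE // gactKV.
Qed.

Fact orbit_id e w : w \in orbit_dom e -> orbit_gact (gid e) w = w.
Proof. by case/imsetP => x xe ->; rewrite orbit_gactE ?gdom_id // gact_id. Qed.

Fact orbitM g h w : gdom g = gran h -> w \in orbit_dom (gdom h) ->
  orbit_gact g (orbit_gact h w) = orbit_gact (gmul g h) w.
Proof.
move=> gh /imsetP[x xh ->].
by rewrite !orbit_gactE ?gdomM ?gh ?gact_in // gactM.
Qed.

Definition orbit_gset : gset G orbits := GSet orbit_inj orbit_im orbit_id orbitM.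
End Orbits.

Section PhiStar.
Variables (F : fieldType) (G K : groupoid) (A : algebra F) (gr : grading G A).
Variables (X : finType) (ab : biset G K X).
Local Notation al := (lact ab).
Local Notation la := (orbit_gset ab).
Local Notation B := (smash gr al).
Local Notation S := (smash gr la).
Local Notation C := (smash_comp gr al).
Local Notation D := (smash_comp gr la).

(* a_g delta_w |-> the sum of the a_g delta_y, for y in X_{d(g)} with o(y) = w *)
Definition phi_star : S -> B :=
  dlift (fun i u => \sum_(y | (y \in gset_dom al (gdom i.1)) && (orbit_of ab y == i.2))
                      sdelta gr al i.1 y u : dsum C).

Lemma phi_on : linear_on D (fun i u =>
  \sum_(y | (y \in gset_dom al (gdom i.1)) && (orbit_of ab y == i.2))
     sdelta gr al i.1 y u : dsum C).
Proof.
move=> [g w] k u v /smash_comp_gr ug /smash_comp_gr vg.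
rewrite scaler_sumr -big_split /=; apply: eq_bigr => y _.
exact: smash_comp_single.
Qed.

Lemma phi_star_linear : linear phi_star. Proof. exact: dlift_linear phi_on. Qed.

Lemma phi_star_sdelta g w u : u \in D (g, w) ->
  phi_star (sdelta gr la g w u) =
  \sum_(y | (y \in gset_dom al (gdom g)) && (orbit_of ab y == w)) sdelta gr al g y u.
Proof. by move=> ug; rewrite [LHS](dlift_single phi_on). Qed.

Lemma phi_star0 : phi_star 0 = 0. Proof. exact: dlift0 phi_on. Qed.
Lemma phi_starD c d : phi_star (c + d) = phi_star c + phi_star d.
Proof. exact: (dliftD _ _ phi_on). Qed.

Fact phi_star_zmod : zmod_morphism phi_star.
Proof. exact: zmod_morphism_linear phi_star_linear. Qed.

Lemma phi_starM : {morph phi_star : c d / c * d}.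
Proof.
move=> c d; elim/smash_ind: c => [|g w u c ug IH]; first by rewrite mul0r phi_star0 mul0r.
rewrite mulrDl !phi_starD mulrDl IH; congr (_ + _) => {c IH}.
elim/smash_ind: d => [|h w' v d vh IH]; first by rewrite mulr0 phi_star0 mulr0.
rewrite mulrDr !phi_starD mulrDr IH; congr (_ + _) => {d IH}.
rewrite sdeltaM // !phi_star_sdelta // mulr_suml.
under [RHS]eq_bigr do rewrite mulr_sumr.
have inC k z t x : t \in D (k, z) -> x \in gset_dom al (gdom k) -> t \in C (k, x).
  by move=> /smash_comp_gr tk xk; rewrite smash_comp_in.
have [gh|gh] := eqVneq (gdom g) (gran h); last first.
  rewrite phi_star0 big1 // => x /andP[xg _]; rewrite big1 // => y /andP[yh _].
  by rewrite sdeltaM ?(inC _ _ _ _ ug) ?(inC _ _ _ _ vh) // (negPf gh).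
rewrite exchange_big /=.
have inner y : y \in gset_dom al (gdom h) -> orbit_of ab y = w' ->
    \sum_(x | (x \in gset_dom al (gdom g)) && (orbit_of ab x == w))
       sdelta gr al g x u * sdelta gr al h y v =
    if orbit_gact h w' == w then sdelta gr al (gmul g h) y (u * v) else 0.
  move=> yh yw; have e x : x \in gset_dom al (gdom g) ->
      sdelta gr al g x u * sdelta gr al h y v =
      if gact al h y == x then sdelta gr al (gmul g h) y (u * v) else 0.
    by move=> xg; rewrite sdeltaM ?(inC _ _ _ _ ug) ?(inC _ _ _ _ vh) // gh eqxx.
  rewrite (eq_bigr _ (fun x (H : _ && _) => e x (proj1 (andP H)))).
  rewrite -big_mkcondr /= -yw orbit_gactE //.
  rewrite (eq_bigl (fun x => (x == gact al h y) && (orbit_of ab (gact al h y) == w))).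
    by case: eqP => _; [rewrite (big_pred1 (gact al h y)) // => x; rewrite andbT
                       | rewrite big_pred0 // => x; rewrite andbF].
  move=> x /=; rewrite [gact _ _ _ == x]eq_sym.
  have [->|] := eqVneq x (gact al h y); rewrite ?andbT ?andbF //.
  by rewrite gh gact_in.
rewrite [RHS](eq_bigr _ (fun y (H : _ && _) =>
  inner y (proj1 (andP H)) (eqP (proj2 (andP H))))).
case: ifP => _; last by rewrite phi_star0 big1.
by rewrite phi_star_sdelta ?(smash_mu_in2 gh ug vh) // gdomM.
Qed.

Lemma phi_star1 : phi_star 1 = 1.
Proof.
rewrite !smash_oneE (big_morph phi_star phi_starD phi_star0).
apply: eq_bigr => e _; rewrite (big_morph phi_star phi_starD phi_star0).
under eq_bigr => w we do rewrite phi_star_sdelta ?sone_in // gdom_id.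
rewrite [RHS](partition_big (orbit_of ab) (mem (gset_dom la e))) //=.
by move=> x xe; exact: imset_f.
Qed.

HB.instance Definition _ := GRing.isZmodMorphism.Build S B phi_star phi_star_zmod.
HB.instance Definition _ := GRing.isMonoidMorphism.Build S B phi_star
  (phi_star1, phi_starM).
End PhiStar.
Arguments phi_star {F G K A} gr {X} ab _.

(* T as a right S-module, by right multiplication via phi : S -> T. Right
   S-modules are left modules over the converse ring S^c. *)
Definition rmod_via (S T : pzRingType) (phi : {rmorphism S -> T}) : Type := T.

Section RmodVia.
Variables (S T : pzRingType) (phi : {rmorphism S -> T}).
Local Notation M := (rmod_via phi).

HB.instance Definition _ := GRing.Zmodule.copy M T.

Definition rmod_scale (s : S^c) (m : M) : M := (m : T) * phi s.

Fact rmod_scaleA s t m : rmod_scale s (rmod_scale t m) = rmod_scale (s * t) m.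
Proof. by rewrite /rmod_scale -mulrA -rmorphM. Qed.
Fact rmod_scale1 : left_id 1 rmod_scale.
Proof. by move=> m; rewrite /rmod_scale rmorph1 mulr1. Qed.
Fact rmod_scaleDr : right_distributive rmod_scale +%R.
Proof. by move=> s m n; rewrite /rmod_scale mulrDl. Qed.
Fact rmod_scaleDl m : {morph rmod_scale^~ m : s t / s + t}.
Proof. by move=> s t; rewrite /rmod_scale rmorphD mulrDr. Qed.

HB.instance Definition _ := GRing.Zmodule_isLmodule.Build S^c M
  rmod_scaleA rmod_scale1 rmod_scaleDr rmod_scaleDl.

Lemma rmod_viaE (s : S) (m : M) : (s : S^c) *: m = (m : T) * phi s :> T.
Proof. by []. Qed.
End RmodVia.

Section Endomorphisms.
Variables (F : fieldType) (S : algebra F) (M : lmodType S^c).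

Definition rend : Type := {linear M -> M}.
Coercion rend_linear (f : rend) : {linear M -> M} := f.

HB.instance Definition _ := gen_eqMixin rend.
HB.instance Definition _ := gen_choiceMixin rend.

Implicit Types f g h : rend.

Lemma rendP f g : (forall m, f m = g m) -> f = g.
Proof.
case: f g => [f [[fa] [fs]]] [g [[ga] [gs]]] /= /funext e; subst g.
by rewrite (Prop_irrelevance fa ga) (Prop_irrelevance fs gs).
Qed.

Definition rend_add f g : rend := (f \+ g : M -> M) : {linear M -> M}.
Definition rend_opp f : rend := (\- f : M -> M) : {linear M -> M}.
Definition rend_zero : rend := (\0 : M -> M) : {linear M -> M}.
Definition rend_one : rend := (idfun : M -> M) : {linear M -> M}.
Definition rend_mul f g : rend := (f \o g : M -> M) : {linear M -> M}.

Fact rend_addA : associative rend_add.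
Proof. by move=> f g h; apply: rendP => m /=; rewrite addrA. Qed.
Fact rend_addC : commutative rend_add.
Proof. by move=> f g; apply: rendP => m /=; rewrite addrC. Qed.
Fact rend_add0 : left_id rend_zero rend_add.
Proof. by move=> f; apply: rendP => m /=; rewrite add0r. Qed.
Fact rend_addN : left_inverse rend_zero rend_opp rend_add.
Proof. by move=> f; apply: rendP => m /=; rewrite addNr. Qed.

HB.instance Definition _ :=
  GRing.isZmodule.Build rend rend_addA rend_addC rend_add0 rend_addN.

(* m * (c 1_S): the F-vector space structure on M coming from that of S *)
Definition rend_scale_fun (c : F) f (m : M) : M := (c *: (1 : S) : S^c) *: f m.

Fact rend_scale_linear c f : linear (rend_scale_fun c f).
Proof.
move=> s m n; rewrite /rend_scale_fun linearP scalerDr !scalerA; congr (_ *: _ + _).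
rewrite -[LHS]/((s : S) * (c *: (1 : S))) -[RHS]/((c *: (1 : S)) * (s : S)).
by rewrite -algAr -algAl mulr1 mul1r.
Qed.
HB.instance Definition _ c f :=
  GRing.isLinear.Build S^c M M *:%R (rend_scale_fun c f) (rend_scale_linear c f).

Definition rend_scale (c : F) f : rend := (rend_scale_fun c f : {linear M -> M}).

Fact rend_scaleA b c f : rend_scale b (rend_scale c f) = rend_scale (b * c) f.
Proof.
apply: rendP => m /=; rewrite /rend_scale_fun /= /rend_scale_fun scalerA.
congr (_ *: _); rewrite -[LHS]/((c *: (1 : S)) * (b *: (1 : S))).
by rewrite -algAl mul1r scalerA mulrC.
Qed.
Fact rend_scale1 : left_id 1 rend_scale.
Proof. by move=> f; apply: rendP => m /=; rewrite /rend_scale_fun scale1r scale1r. Qed.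
Fact rend_scaleDr : right_distributive rend_scale +%R.
Proof. by move=> c f g; apply: rendP => m /=; rewrite /rend_scale_fun -scalerDr. Qed.
Fact rend_scaleDl f : {morph rend_scale^~ f : b c / b + c}.
Proof.
move=> b c; apply: rendP => m /=; rewrite /rend_scale_fun -scalerDl.
by congr (_ *: _); rewrite scalerDl.
Qed.
HB.instance Definition _ := GRing.Zmodule_isLmodule.Build F rend
  rend_scaleA rend_scale1 rend_scaleDr rend_scaleDl.

Fact rend_mulA : associative rend_mul.
Proof. by move=> f g h; apply: rendP. Qed.
Fact rend_mul1 : left_id rend_one rend_mul.
Proof. by move=> f; apply: rendP. Qed.
Fact rend_mul_1 : right_id rend_one rend_mul.
Proof. by move=> f; apply: rendP. Qed.
Fact rend_mulDl : left_distributive rend_mul +%R.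
Proof. by move=> f g h; apply: rendP. Qed.
Fact rend_mulDr : right_distributive rend_mul +%R.
Proof. by move=> f g h; apply: rendP => m; exact: (linearD f). Qed.
Fact rend_mulAl (c : F) f g : c *: rend_mul f g = rend_mul (c *: f) g.
Proof. by apply: rendP. Qed.
Fact rend_mulAr (c : F) f g : c *: rend_mul f g = rend_mul f (c *: g).
Proof. by apply: rendP => m; exact/esym/(linearZ_LR f). Qed.

Definition End_alg : algebra F := Algebra rend_mulA rend_mul1 rend_mul_1
  rend_mulDl rend_mulDr rend_mulAl rend_mulAr.
End Endomorphisms.

Section SmashModule.
Variables (F : fieldType) (G K : groupoid) (A : algebra F) (gr : grading G A).
Variables (X : finType) (ab : biset G K X).

(* A # X as a right A # O^K-module *)
Definition smash_rmod := rmod_via (phi_star gr ab).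
HB.instance Definition _ := GRing.Lmodule.on smash_rmod.

Lemma smash_rmod_scaleE (c : F) (f : rend smash_rmod) (m : smash_rmod) :
  (c *: f) m = c *: (f m : smash gr (lact ab)).
Proof.
pose u : smash gr (orbit_gset ab) := 1.
have -> : (c *: f) m = (f m : smash gr (lact ab)) * phi_star gr ab (c *: u) by [].
have -> : phi_star gr ab (c *: u) = c *: (1 : smash gr (lact ab)).
  have := phi_star_linear c u 0; rewrite addr0 => ->.
  by rewrite phi_star0 addr0 phi_star1.
by rewrite -algAr mulr1.
Qed.
End SmashModule.

(* Main.v *)
Require Import Defs.
From HB Require Import structures.
From mathcomp Require Import all_boot all_algebra.
From mathcomp Require Import boolp.

Set Implicit Arguments.
Unset Strict Implicit.
Unset Printing Implicit Defensive.

Import GRing.Theory.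
Local Open Scope ring_scope.

(** Write B = A # X, S = A # O and [phi : S -> B] for [phi_star].  Since the
    K-action is split, 1_B is the sum of the central idempotents 1_p of the
    ideals E_p, so every gamma_k extends to the map [shift k], b |->
    gamma_k(b 1_{d(k)}), defined on the whole of B.  The isomorphism sends
    c delta_k to the map b |-> c * [shift k b].  The coefficients of [phi s] are
    constant on K-orbits, so [shift k] commutes with right multiplication by
    [phi s] ([shift_phiM]), and these maps are right S-linear; they multiply
    like the elements of the skew groupoid ring ([skew_actM]) because the E_p
    annihilate each other.

    Bijectivity rests on the orthogonal idempotents [eps e x] = 1_e delta_x, x
    in X_e, and the fact that c delta_k maps [eps e x] to c * [eps e (beta_k x)]
    when x lies in Y_{d(k)}, and to 0 otherwise.

    Injectivity: full faithfulness makes the points beta_k(x), for k starting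
    at x, pairwise distinct ([faithful_inj]).  Hence the coefficients of r can
    be read off from the values of its image at the [eps e x]
    ([skew_act_coef]).

    Surjectivity: [eps e x] is fixed by right multiplication by
    [phi (1_e delta_{o(x)})], which is the sum of the [eps e y] with y in X_e
    and in the orbit of x.  So a right linear f satisfies
    [f (eps e x) = \sum_y f (eps e x) * eps e y], and writing y = beta_k(x),
    the y-th term is the value at [eps e x] of the element
    ([f (eps e x) * eps e y]) delta_k, which kills every other idempotent
    ([skew_act_unit]).  As the [eps e x] generate B over S
    ([right_linear_ext]), summing over e, x and y gives a preimage of f. *)

(** * Fully faithful split actions *)

Section SplitAction.
Variables (K : groupoid) (X : finType) (be : gset K X).

(** If k and l agree at x, then k and l are parallel, because the action is
    split, and l^-1 k fixes x, hence is an identity. *)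
Lemma faithful_inj (k l : K) x : gset_split be -> fully_faithful be ->
  x \in gset_dom be (gdom k) -> x \in gset_dom be (gdom l) ->
  gact be k x = gact be l x -> k = l.
Proof.
move=> [_ uni] ff xk xl e.
have kl : gdom k = gdom l by apply: uni xk xl.
have rkl : gran k = gran l.
  by apply: (uni _ _ (gact be k x)); [exact: gact_in | rewrite e gact_in].
have lk : gdom (ginv l) = gran k by rewrite gdomV.
have [] := ff (gmul (ginv l) k) x.
- by rewrite inE granM // granV gdomM // xk xl.
- by rewrite -gactM // e gactVK.
move=> p ep.
have ekp : gmul l (gmul (ginv l) k) = k by rewrite gmulA ?granV // gmulV -rkl gmul1.
have pE : p = gdom l.
  by rewrite -(gdom_id p) -ep gdomM.
by rewrite -ekp ep pE gmul_1.
Qed.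
End SplitAction.

Section SkewAct.
Variables (F : fieldType) (G K : groupoid) (A : algebra F) (gr : grading G A).
Variables (X : finType) (ab : biset G K X).
Local Notation al := (lact ab).
Local Notation be := (ract ab).
Local Notation la := (orbit_gset ab).
Local Notation B := (smash gr al).
Local Notation S := (smash gr la).
Local Notation C := (smash_comp gr al).
Local Notation E := (sact_dom gr ab).
Local Notation R := (skew_ring (smash_action gr ab)).
Local Notation I1 := (sact_one gr ab).
Local Notation gam := (@sact F G K A gr X ab).
Local Notation phi := (phi_star gr ab).

Hypothesis sp : gset_split be.
Hypothesis ff : fully_faithful be.

(** * Orbits and the ideals of a split action *)

Lemma orbit_of_act k x : x \in gset_dom be (gdom k) ->
  orbit_of ab (gact be k x) = orbit_of ab x.
Proof.
move=> xk; apply/orbit_of_eq/finset.setP => z; apply/Defs.in_orbit/Defs.in_orbit => -[l].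
  move=> kxl ->; have lk : gdom l = gran k by apply: sp.2 kxl _; exact: gact_in.
  by exists (gmul l k); rewrite ?gdomM // gactM.
move=> xl ->; have lk : gdom l = gdom k by apply: sp.2 xl xk.
have lk' : gdom l = gran (ginv k) by rewrite granV.
exists (gmul l (ginv k)); first by rewrite gdomM // gdomV gact_in.
by rewrite -gactM // ?gdomV ?gact_in // gactVK.
Qed.

Lemma orbit_of_eq_act x y : orbit_of ab x = orbit_of ab y ->
  exists2 k : K, x \in gset_dom be (gdom k) & y = gact be k x.
Proof.
move=> /orbit_of_eq xy; apply/Defs.in_orbit; rewrite xy; apply/Defs.in_orbit.
have [p yp] := sp.1 y; exists (gid p); first by rewrite gdom_id.
by rewrite gact_id.
Qed.

Lemma sact_dom_disj p q (c : B) : p <> q -> c \in E p -> c \in E q -> c = 0.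
Proof.
move=> pq /asboolP cp /asboolP cq; apply/dsumP => -[g x].
have [xp|/cp->//] := boolP (x \in gset_dom be p).
by rewrite cq //; apply/negP => xq; apply: pq; exact: sp.2 xp xq.
Qed.

Lemma mul_sact_one_in (b : B) p : b * I1 p \in E p.
Proof. by have [] := sact_ideal b (sact_one_in gr ab p). Qed.

(** Both sides lie in the ideal E_p, where 1_p is a two-sided identity. *)
Lemma sact_oneC (b : B) p : b * I1 p = I1 p * b.
Proof.
have [bp pb] := sact_ideal b (sact_one_in gr ab p).
by rewrite -[LHS](sact_mul1 bp) mulrA (sact_mul_1 pb).
Qed.

Lemma sdelta_sact_one g x u p : u \in C (g, x) ->
  sdelta gr al g x u * I1 p = if x \in gset_dom be p then sdelta gr al g x u else 0.
Proof.
move=> ug; case: ifP => xp; first by rewrite sact_mul_1 // sact_dom_single.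
have [q xq] := sp.1 x; apply: (@sact_dom_disj p q).
- by move=> pq; rewrite pq xq in xp.
- exact: mul_sact_one_in.
- by have [] := sact_ideal (I1 p) (sact_dom_single ug xq).
Qed.

Lemma sum_sact_one : \sum_p I1 p = 1 :> B.
Proof.
rewrite smash_oneE exchange_big /=; apply: eq_bigr => e _.
rewrite (exchange_big_dep (mem (gset_dom al e))) /=; last first.
  by move=> p x _; rewrite inE => /andP[].
apply: eq_bigr => x xe; have [p xp] := sp.1 x.
rewrite (big_pred1 p) // => q; rewrite /= inE xe /=.
by apply/idP/eqP => [xq|->//]; exact: sp.2 xq xp.
Qed.

(** * Right linear maps from the skew groupoid ring *)

(** Composing with the projection onto E_{d(k)} makes gamma_k total; the result
    is still multiplicative because 1_{d(k)} is a central idempotent. *)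
Definition shift (k : K) (b : B) : B := gam k (b * I1 (gdom k)).

Lemma shiftD k b c : shift k (b + c) = shift k b + shift k c.
Proof. by rewrite /shift mulrDl sactD. Qed.

Lemma shift0 k : shift k 0 = 0.
Proof. by rewrite /shift mul0r sact0. Qed.

Lemma shift_in k b : shift k b \in E (gran k).
Proof. by apply: sact_in; exact: mul_sact_one_in. Qed.

Lemma shiftM k b c : shift k (b * c) = shift k b * shift k c.
Proof.
rewrite /shift -(sact_mul (mul_sact_one_in _ _) (mul_sact_one_in _ _)).
congr (sact _ _).
by rewrite [RHS]mulrA -(mulrA b (I1 _)) -sact_oneC -!mulrA (sact_mul_1 (sact_one_in _ _ _)).
Qed.

Lemma shift_sdelta k g x u : u \in C (g, x) -> shift k (sdelta gr al g x u) =
  if x \in gset_dom be (gdom k) then sdelta gr al g (gact be k x) u else 0.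
Proof.
move=> ug; rewrite /shift sdelta_sact_one //; case: ifP => _; first exact: sact_sdelta.
exact: sact0.
Qed.

(** [phi s] is constant along K-orbits, so gamma_k carries its part over
    Y_{d(k)} to its part over Y_{r(k)}. *)
Lemma shift_phi_star k (s : S) : shift k (phi s) = phi s * I1 (gran k).
Proof.
elim/smash_ind: s => [|g w u c ug IH]; first by rewrite phi_star0 shift0 mul0r.
rewrite !phi_starD shiftD mulrDl {}IH; congr (_ + _).
rewrite phi_star_sdelta // (big_morph _ (shiftD k) (shift0 k)) mulr_suml.
have uC x : x \in gset_dom al (gdom g) -> u \in C (g, x).
  by move=> xg; rewrite smash_comp_in // (smash_comp_gr ug).
under eq_bigr => x /andP[xg _] do rewrite shift_sdelta ?uC //.
under [RHS]eq_bigr => x /andP[xg _] do rewrite sdelta_sact_one ?uC //.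
rewrite -!big_mkcondr /=.
(* beta_k is a bijection from Y_{d(k)} to Y_{r(k)} preserving X_{d(g)} and orbits *)
rewrite [RHS](reindex_onto (gact be k) (gact be (ginv k))) /=; last first.
  by move=> x /andP[_ xk]; rewrite gactKV.
apply: eq_bigl => x; have [xk|xk] := boolP (x \in gset_dom be (gdom k)).
  by rewrite ract_inE // orbit_of_act // gact_in // gactVK // eqxx !andbT.
rewrite andbF; apply/esym/negbTE/negP => /andP[/andP[_ kx] /eqP e].
by case/negP: xk; rewrite -e -granV gact_in // gdomV.
Qed.

Lemma shift_phiM k b (s : S) : shift k (b * phi s) = shift k b * phi s.
Proof. by rewrite shiftM shift_phi_star sact_oneC mulrA (sact_mul_1 (shift_in _ _)). Qed.

Definition right_linear (f : B -> B) : Prop :=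
  forall b b' (s : S), f (b * phi s + b') = f b * phi s + f b'.

Lemma right_linear0 f : right_linear f -> f 0 = 0.
Proof.
move=> fl; have := fl 0 0 (-1).
by rewrite rmorphN rmorph1 mulrN1 oppr0 add0r mulrN1 addNr.
Qed.

Definition skew_act (r : R) (b : B) : B :=
  dlift (fun k (c : B) => (c * shift k b : B) : alg_lmod B) r.

Lemma skew_act_on b : linear_on (skew_comp (smash_action gr ab))
  (fun k (c : B) => (c * shift k b : B) : alg_lmod B).
Proof. by move=> k a c c' _ _; rewrite mulrDl -algAl. Qed.

Lemma skew_act_linl b : linear (skew_act^~ b).
Proof. exact: dlift_linear (skew_act_on b). Qed.

Lemma skew_actDl b r r' : skew_act (r + r') b = skew_act r b + skew_act r' b.
Proof. exact: (dliftD _ _ (skew_act_on b)). Qed.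

Lemma skew_act0l b : skew_act 0 b = 0.
Proof. exact: dlift0 (skew_act_on b). Qed.

Lemma skew_act_kdelta k c b : c \in E (gran k) ->
  skew_act (kdelta (smash_action gr ab) k c) b = c * shift k b.
Proof. by move=> ck; rewrite [LHS](dlift_single (skew_act_on b)). Qed.

Lemma skew_ind (P : R -> Prop) : P 0 ->
  (forall k c r, c \in E (gran k) -> P r -> P (kdelta (smash_action gr ab) k c + r)) ->
  forall r, P r.
Proof. by move=> P0 PD; exact: dsum_ind. Qed.

(** Each term is right linear because the factor [phi s] passes through the
    shifts. *)
Lemma skew_act_linr r : right_linear (skew_act r).
Proof.
move=> b b' s; elim/skew_ind: r => [|k c r ck IH]; first by rewrite !skew_act0l mul0r addr0.
rewrite !skew_actDl IH !skew_act_kdelta // shiftD shift_phiM mulrDr mulrDl !mulrA.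
by rewrite addrACA.
Qed.

Lemma skew_actDr r b b' : skew_act r (b + b') = skew_act r b + skew_act r b'.
Proof. by have := skew_act_linr r b b' 1; rewrite phi_star1 !mulr1. Qed.

Lemma skew_act0r r : skew_act r 0 = 0.
Proof. exact: right_linear0 (skew_act_linr r). Qed.

Lemma skew_act1 b : skew_act 1 b = b.
Proof.
rewrite skew_oneE (big_morph (skew_act^~ b) (skew_actDl b) (skew_act0l b)).
rewrite -[RHS]mulr1 -sum_sact_one mulr_sumr; apply: eq_bigr => p _.
rewrite skew_act_kdelta ?gran_id ?sact_one_in //= /shift gdom_id.
by rewrite sact_id ?mul_sact_one_in // sact_mul1 ?mul_sact_one_in.
Qed.

(** When d(k) and r(l) differ, the product of the two generators is 0, and so is
    the composite, because shifting by l lands in E_{r(l)}, which meets E_{d(k)}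
    trivially. *)
Lemma skew_actM r r' b : skew_act (r * r') b = skew_act r (skew_act r' b).
Proof.
elim/skew_ind: r => [|k c r ck IH]; first by rewrite mul0r !skew_act0l.
rewrite mulrDl !skew_actDl {}IH; congr (_ + _).
elim/skew_ind: r' => [|l d r' dl IH]; first by rewrite mulr0 !skew_act0l skew_act0r.
rewrite mulrDr !skew_actDl skew_actDr {}IH; congr (_ + _).
have dbl : d * shift l b \in E (gran l) by have [] := sact_ideal d (shift_in l b).
rewrite kdeltaM // !skew_act_kdelta //; have [kl|kl] := eqVneq.
  have ckd : c * gam k d \in E (gran (gmul k l)).
    by rewrite granM //; have [] := sact_ideal (gam k d) ck.
  have dE : shift k d = gam k d by rewrite /shift kl (sact_mul_1 dl).
  have klE : shift k (shift l b) = shift (gmul k l) b.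
    rewrite /shift gdomM // (sactM kl (mul_sact_one_in _ _)) kl.
    by rewrite (sact_mul_1 (shift_in l b)).
  by rewrite skew_act_kdelta // -mulrA shiftM dE klE.
rewrite skew_act0l /shift.
have -> : d * shift l b * I1 (gdom k) = 0.
  apply: (@sact_dom_disj (gdom k) (gran l)); first exact/eqP.
    exact: mul_sact_one_in.
  by have [] := sact_ideal (I1 (gdom k)) dbl.
by rewrite sact0 mulr0.
Qed.

(** * Reading off the coefficients *)

Definition eps (e : gob G) (x : X) : B := sdelta gr al (gid e) x (gr_one gr e).

(** Right multiplication by [eps e z] keeps the part of b supported at z in the
    degrees with domain e. *)
Lemma mul_epsE (b : B) e z g y : z \in gset_dom al e ->
  dval (b * eps e z) (g, y) = if (gdom g == e) && (y == z) then dval b (g, y) else 0.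
Proof.
move=> ze; elim/smash_ind: b => [|h x u b uh IH]; first by rewrite mul0r if_same.
rewrite mulrDl !dvalD {}IH sdeltaM ?sone_in // gran_id gact_id //.
have -> : dval (if (gdom h == e) && (z == x) then
    sdelta gr al (gmul h (gid e)) z (u * gr_one gr e) else 0) (g, y) =
    if (gdom g == e) && (y == z) then dval (sdelta gr al h x u) (g, y) else 0.
  case: ifPn => [/andP[/eqP he /eqP zx]|hz].
    subst e x; rewrite gmul_1 gr_mul_one ?(smash_comp_gr uh) //.
    case: ifPn => // n; rewrite dsingleE //; case: eqP => // -[eg ey].
    by rewrite eg ey !eqxx in n.
  case: ifPn => // /andP[/eqP ge /eqP yz]; rewrite dsingleE //; case: eqP => // -[eg ex].
  by rewrite -eg ge -ex yz !eqxx in hz.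
by case: ifP => // _; rewrite addr0.
Qed.

Lemma eps_mul e x e' x' : x \in gset_dom al e -> x' \in gset_dom al e' ->
  eps e x * eps e' x' = if (e == e') && (x == x') then eps e x else 0.
Proof.
move=> xe xe'; rewrite /eps sdeltaM ?sone_in // gdom_id gran_id gact_id //.
rewrite [x == x']eq_sym; case: ifP => // /andP[/eqP ee' /eqP xx']; subst e' x'.
rewrite -[in X in gmul _ X](gdom_id e) gmul_1.
by rewrite -[in X in _ * X](gdom_id e) gr_mul_one // gr_one_in.
Qed.

Lemma shift_eps k e x : x \in gset_dom al e ->
  shift k (eps e x) = if x \in gset_dom be (gdom k) then eps e (gact be k x) else 0.
Proof. by move=> xe; rewrite shift_sdelta ?sone_in. Qed.

Lemma kdelta_coef k (c : B) l : c \in E (gran k) ->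
  dval (kdelta (smash_action gr ab) k c) l = (if l == k then c else 0) :> B.
Proof. exact: (dsingleE (S := skew_comp (smash_action gr ab))). Qed.

Lemma skew_coefD (r r' : R) k i :
  dval (dval (r + r') k : B) i = dval (dval r k : B) i + dval (dval r' k : B) i.
Proof. by []. Qed.

(** By full faithfulness, among the components r_l only r_k contributes at the
    point beta_k(x). *)
Lemma skew_act_coef r k g x :
  x \in gset_dom al (gdom g) -> x \in gset_dom be (gdom k) ->
  dval (skew_act r (eps (gdom g) x)) (g, gact be k x) =
  dval (dval r k : B) (g, gact be k x).
Proof.
move=> xg xk; elim/skew_ind: r => [|l c r cl IH]; first by rewrite skew_act0l.
rewrite skew_actDl skew_coefD [LHS]dvalD {}IH; congr (_ + _).
rewrite skew_act_kdelta // shift_eps // kdelta_coef //.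
case: ifP => xl; last first.
  by rewrite mulr0; case: eqP => // kl; rewrite -kl xk in xl.
rewrite mul_epsE ?ract_in // eqxx /=.
case: (k =P l) => [->|kl]; first by rewrite eqxx.
by case: eqP => // /(faithful_inj sp ff xk xl).
Qed.

(** Every point of Y_{r(k)} is beta_k(x) for some x, so all coefficients of r
    are obtained from [skew_act_coef]. *)
Lemma skew_act_inj r : (forall b, skew_act r b = 0) -> r = 0.
Proof.
move=> r0; apply/dsumP => k; apply/dsumP => -[g y].
have [yk|yk] := boolP (y \in gset_dom be (gran k)); last first.
  by have /asboolP -> := dval_in r k.
have [yg|yg] := boolP (y \in gset_dom al (gdom g)); last first.
  exact: (smash_comp_out yg (dval_in (dval r k : B) (g, y))).
have xk : gact be (ginv k) y \in gset_dom be (gdom k) by rewrite -granV gact_in ?gdomV.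
have := @skew_act_coef r k g (gact be (ginv k) y).
by rewrite gactKV // ract_inE ?gdomV // r0 => /(_ yg xk) <-.
Qed.

(** * Realising a right linear map *)

(** As alpha_g is injective on X_{d(g)}, only the term of index x survives in
    [phi (u delta_{o(x)})]. *)
Lemma eps_phi_sdelta g x u : u \in C (g, x) -> x \in gset_dom al (gdom g) ->
  eps (gran g) (gact al g x) * phi (sdelta gr la g (orbit_of ab x) u) =
  sdelta gr al g x u.
Proof.
move=> ug xg; have uC y : y \in gset_dom al (gdom g) -> u \in C (g, y).
  by move=> yg; rewrite smash_comp_in // (smash_comp_gr ug).
rewrite phi_star_sdelta ?smash_comp_in ?imset_f ?(smash_comp_gr ug) //.
rewrite mulr_sumr (bigD1 x) ?xg ?eqxx //= big1 ?addr0 => [|y /andP[/andP[yg _] yx]].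
  rewrite sdeltaM ?sone_in ?gact_in // gdom_id !eqxx /= gmul1 gr_one_mul //.
  exact: smash_comp_gr ug.
rewrite sdeltaM ?sone_in ?gact_in ?uC // gdom_id eqxx /=.
by case: eqP => // /(gact_inj yg xg) e; rewrite e eqxx in yx.
Qed.

Lemma eps_orbit e x : x \in gset_dom al e ->
  eps e x * phi (sdelta gr la (gid e) (orbit_of ab x) (gr_one gr e)) = eps e x.
Proof.
move=> xe; have := @eps_phi_sdelta (gid e) x (gr_one gr e).
by rewrite gran_id gdom_id gact_id // sone_in //; apply.
Qed.

(** The [eps e x] generate A # X as a right module. *)
Lemma right_linear_ext (f f' : B -> B) : right_linear f -> right_linear f' ->
  (forall e x, x \in gset_dom al e -> f (eps e x) = f' (eps e x)) -> f =1 f'.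
Proof.
move=> fl fl' ff'.
elim/smash_ind => [|g x u b ug IH]; first by rewrite !right_linear0.
have [xg|xg] := boolP (x \in gset_dom al (gdom g)); last first.
  by rewrite (smash_comp_out xg ug) /sdelta dsingle0 add0r.
by rewrite -(eps_phi_sdelta ug xg) fl fl' IH ff' ?gact_in.
Qed.

(** These maps play the role of matrix units: if y = beta_k(x), the element
    (b * [eps e y]) delta_k sends [eps e x] to b * [eps e y] and kills the other
    idempotents. *)
Lemma skew_act_unit b e x y : x \in gset_dom al e -> y \in gset_dom al e ->
  orbit_of ab x = orbit_of ab y ->
  exists r, forall e' x', x' \in gset_dom al e' ->
    skew_act r (eps e' x') = if (e == e') && (x == x') then b * eps e y else 0.
Proof.
move=> xe ye /orbit_of_eq_act[k xk yE].
have epsk : eps e y \in E (gran k) by rewrite sact_dom_single ?sone_in // yE gact_in.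
exists (kdelta (smash_action gr ab) k (b * eps e y)) => e' x' xe'.
rewrite skew_act_kdelta; last by have [] := sact_ideal b epsk.
rewrite shift_eps //; case: ifP => xk'; last first.
  by rewrite mulr0; case: andP => // -[_ /eqP xx']; rewrite -xx' xk in xk'.
rewrite -mulrA eps_mul ?ract_in // yE.
have -> : (gact be k x == gact be k x') = (x == x').
  by apply/eqP/eqP => [/gact_inj-> //|->].
by case: ifP => // _; rewrite mulr0.
Qed.

(** The element [phi (1_e delta_{o(x)})] is the sum of the [eps e y] with y in
    X_e and in the orbit of x, so [f (eps e x) = \sum_y f (eps e x) * eps e y]; each of
    these finitely many terms comes from a single [kdelta]. *)
Lemma skew_act_surj (f : B -> B) : right_linear f -> exists r, skew_act r =1 f.
Proof.
move=> fl.
pose Q (i : gob G * X * X) := [&& i.1.2 \in gset_dom al i.1.1, i.2 \in gset_dom al i.1.1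
  & orbit_of ab i.2 == orbit_of ab i.1.2].
(* u (e, x, y) has the y-th term of f (eps e x) as its value at eps e x *)
have /choice[u uP] : forall i, exists r, Q i -> forall e' x', x' \in gset_dom al e' ->
    skew_act r (eps e' x') =
    if (i.1.1 == e') && (i.1.2 == x') then f (eps i.1.1 i.1.2) * eps i.1.1 i.2 else 0.
  move=> [[e x] y]; case: (boolP (Q (e, x, y))) => [/and3P[/= xe ye /eqP yx]|_]; last by exists 0.
  by have [r rP] := skew_act_unit (f (eps e x)) xe ye (esym yx); exists r.
exists (\sum_(e : gob G) \sum_(x in gset_dom al e)
  \sum_(y | (y \in gset_dom al e) && (orbit_of ab y == orbit_of ab x)) u (e, x, y)).
apply: right_linear_ext => // [|e' x' xe']; first exact: skew_act_linr.
have D := big_morph (skew_act^~ (eps e' x')) (skew_actDl _) (skew_act0l _).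
rewrite D; under eq_bigr do rewrite D; under eq_bigr do under eq_bigr do rewrite D.
have uE e x y : x \in gset_dom al e -> (y \in gset_dom al e) && (orbit_of ab y == orbit_of ab x) ->
    skew_act (u (e, x, y)) (eps e' x') =
    if (e == e') && (x == x') then f (eps e x) * eps e y else 0.
  by move=> xe /andP[ye yx]; rewrite uP // /Q /= xe ye.
rewrite (bigD1 e') //= [X in _ + X]big1 ?addr0; last first.
  move=> e /negPf ee'; rewrite big1 // => x xe; rewrite big1 // => y yP.
  by rewrite uE // ee'.
rewrite (bigD1 x') //= [X in _ + X]big1 ?addr0; last first.
  move=> x /andP[xe /negPf xx']; rewrite big1 // => y yP.
  by rewrite uE // xx' andbF.
under eq_bigr => y yP do rewrite uE // !eqxx /=.
rewrite -mulr_sumr -[in RHS](eps_orbit xe') -[in RHS](addr0 (_ * _)) fl.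
rewrite (right_linear0 fl) addr0 phi_star_sdelta; last first.
  by rewrite smash_comp_in ?gr_one_in // gdom_id imset_f.
by rewrite gdom_id.
Qed.
End SkewAct.

Theorem theorem1 (F : fieldType) (G K : groupoid) (A : algebra F)
    (gr : grading G A) (X : finType) (ab : biset G K X) :
  gset_split (lact ab) -> gset_split (ract ab) -> fully_faithful (ract ab) ->
  alg_isom (skew_ring (smash_action gr ab))
           (End_alg (S := smash gr (orbit_gset ab)) (smash_rmod gr ab)).
Proof.
move=> _ sp ff.
pose M := smash_rmod gr ab.
have lin r : linear (skew_act r : M -> M).
  by move=> s m n; exact: skew_act_linr.
pose f (r : skew_ring (smash_action gr ab)) : rend M :=
  HB.pack_for {linear M -> M} (skew_act r : M -> M)
    (GRing.isLinear.Build _ _ _ _ (skew_act r : M -> M) (lin r)).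
have fE r b : f r b = skew_act r b by [].
exists f; split.
- move=> k r r'; apply: rendP => b.
  have -> : (k *: f r + f r') b = k *: (f r b : smash gr (lact ab)) + f r' b.
    by rewrite -smash_rmod_scaleE.
  exact: skew_act_linl.
- split; first by apply: rendP => b; exact: skew_act1.
  by move=> r r'; apply: rendP => b; exact: skew_actM.
have surj (g : rend M) : exists r, f r = g.
  have [r rg] := @skew_act_surj _ _ _ _ _ _ _ sp (g : M -> M) (fun m n s => linearP g s m n).
  by exists r; apply: rendP => b; exact: rg.
exists (fun g => projT1 (cid (surj g))) => [r|g]; last exact: (projT2 (cid (surj g))).
apply/eqP; rewrite -subr_eq0; apply/eqP/(skew_act_inj sp ff) => b.
set r' := projT1 _; have e : f r' = f r := projT2 (cid (surj (f r))).
have := skew_act_linl b (-1) r r'; rewrite scaleN1r [- r + _]addrC => ->.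
by rewrite -!fE e scaleN1r addNr.
Qed.
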